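(* The essential range of the contravariant functor $\mathcal{P}:\mathbf{SDS}\to\mathbf{OBD}$ is $\mathbf{OBD}_{\mathrm{po}}$; that is, an ordered Bratteli diagram is isomorphic in $\mathbf{OBD}$ to $\mathcal{P}(\mathcal{X})$ for some $\mathcal{X}$ in $\mathbf{SDS}$ if and only if it is properly ordered.
   Context: **Bratteli diagrams.** A Bratteli diagram $(V,E)$ consists of a vertex set $V=V_0\sqcup V_1\sqcup\cdots$ with each $V_n$ finite and non-empty and $V_0$ a singleton, and an edge set $E=E_1\sqcup E_2\sqcup\cdots$ with each $E_n$ finite and non-empty, together with maps $r,s:E\to V$ (range, source) such that $r(E_n)\subseteq V_n$, $s(E_n)\subseteq V_{n-1}$, $s^{-1}\{v\}\neq\varnothing$ for all $v\in V$ and $r^{-1}\{v\}\ne\varnothing$ for all $v\in V\setminus V_0$. An ordered Bratteli diagram $(V,E,\geq)$ is a Bratteli diagram with a partial order on $E$ such that $e,e'$ are comparable iff $r(e)=r(e')$. It is properly ordered if there is exactly one infinite path $(e_1,e_2,\ldots)$ ($e_i\in E_i$, $r(e_i)=s(e_{i+1})$) consisting of maximal edges, and exactly one consisting of minimal edges. **Edge sets.** An ordered edge set from a finite set $S$ to a finite set $T$ is a finite set $F$ with maps $s:F\to S$, $r:F\to T$ and a linear order on each $r^{-1}\{w\}$, $w\in T$. If $G$ is an ordered edge set from $T$ to $U$, then $F\circ G=\{(e,g)\in F\times G: r(e)=s(g)\}$, with source $s(e)$, range $r(g)$, and order: for $r(g)=r(g')$, $(e,g)<(e',g')$ iff $g<g'$,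 or $g=g'$ and $e<e'$. Write $F\cong F'$ if there is a bijection $F\to F'$ preserving sources, ranges and order. For $k<l$, $E_{k,l}=E_{k+1}\circ\cdots\circ E_l$; $E_{k,k}$ consists of one edge from $v$ to $v$ for each $v\in V_k$. **The category $\mathbf{OBD}$.** Objects: ordered Bratteli diagrams. An ordered premorphism $f:B=(V,E,\ge)\to C=(W,S,\ge)$ is a triple $(F,(f_n)_{n\ge0},\geq)$ where $(f_n)$ is an unbounded sequence of integers with $0=f_0\le f_1\le\cdots$, and $F=F_0\sqcup F_1\sqcup\cdots$ where each $F_n$ is a non-empty finite ordered edge set from $V_n$ to $W_{f_n}$ such that every $v\in V_n$ is the source and every $w\in W_{f_n}$ the range of some edge of $F_n$, $F_0$ is a singleton, and $E_{n+1}\circ F_{n+1}\cong F_n\circ S_{f_n,f_{n+1}}$ for all $n\ge0$. The composition of $f:B\to C$ and $g=(G,(g_n),\ge):C\to D$ is $gf=(H,(h_n),\ge)$ with $h_n=g_{f_n}$, $H_n=F_n\circ G_{f_n}$. Premorphisms $f,g:B\to C$ are equivalent if there are positive integers $n_1<m_1<n_2<m_2<\cdots$ with $f_{n_k}<g_{m_k}<f_{n_{k+1}}$ and, for all $k\ge1$, $E_{n_k,m_k}\circ G_{m_k}\cong F_{n_k}\circ S_{f_{n_k},g_{m_k}}$ and $E_{m_k,n_{k+1}}\circ F_{n_{k+1}}\cong G_{m_k}\circ S_{g_{m_k},f_{n_{k+1}}}$. Morphisms in $\mathbf{OBD}$ are equivalence classes $[f]$, with $[g][f]=[gf]$. $\mathbf{OBD}_{\mathrm{po}}$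 is the full subcategory of properly ordered Bratteli diagrams. **Objects of $\mathbf{SDS}$.** An essentially minimal totally disconnected dynamical system $(X,\varphi,x_0)$ consists of a metrizable compact totally disconnected space $X$, a homeomorphism $\varphi$ of $X$ such that $(X,\varphi)$ has a unique minimal (non-empty closed invariant) subset, and a point $x_0$ of that subset. A Kakutani–Rokhlin partition for it is a finite partition $P=\{Z(k,j): 1\le k\le K,\ 1\le j\le J(k)\}$ of $X$ into non-empty clopen sets with $\varphi(Z(k,j))=Z(k,j+1)$ for $1\le j<J(k)$, and such that the top $Z=\bigcup_kZ(k,J(k))$ contains $x_0$ and $\varphi(Z)=\bigcup_kZ(k,1)$; the sequences $(Z(k,1),\ldots,Z(k,J(k)))$ are its towers. A system of Kakutani–Rokhlin partitions is a sequence $\mathcal{R}=(P_n)_{n\ge0}$ of such partitions with $P_0=\{X\}$, $P_{n+1}$ refining $P_n$ (written $P_n\le P_{n+1}$), the tops $Z_n$ of $P_n$ ($n\ge1$) decreasing with intersection $\{x_0\}$, and $\bigcup_nP_n$ a basis for the topology of $X$. Objects of $\mathbf{SDS}$ are quadruples $(X,\varphi,x_0,\mathcal{R})$. **$\mathcal{P}$ on objects.** If $P\le Q$ are Kakutani–Rokhlin partitions and the top of $P$ contains the top of $Q$, $E(P,Q)$ is the set of triples $(S,T,k)$ with $S=(Z_1,\ldots,Z_n)$ a tower of $P$, $T=(Y_1,\ldots,Y_m)$ a tower of $Q$, $k\ge0$ an integer with $Y_{k+j}\subseteq Z_j$ for $1\le j\le n$; source $S$, range $T$, and $(S,T,k)\le(S',T',k')$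 iff $T=T'$ and $k\le k'$. For $\mathcal{R}=(P_n)$, $\mathcal{P}(X,\varphi,x_0,\mathcal{R})$ is the ordered Bratteli diagram with $V_n=\{(n,T): T\text{ a tower of }P_n\}$ and $E_n$ the copy $\{(n,S,T,k):(S,T,k)\in E(P_{n-1},P_n)\}$ of $E(P_{n-1},P_n)$ with its order. *)

(* Defs.v *)
From HB Require Import structures.
From mathcomp Require Import all_boot all_order all_algebra.
From mathcomp Require Import all_classical all_reals all_analysis.

Set Implicit Arguments.
Unset Strict Implicit.
Unset Printing Implicit Defensive.

Local Open Scope classical_set_scope.

(* A relation that is reflexive, antisymmetric and transitive and for which two
   edges are comparable exactly when they have the same range is the same thing
   as a family of linear orders on the fibres of [rng]. *)
Record oedges (S T : finType) := OEdges {
  edge :> finType;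
  src : edge -> S;
  rng : edge -> T;
  ele : rel edge;
  ele_refl : reflexive ele;
  ele_anti : antisymmetric ele;
  ele_trans : transitive ele;
  ele_comparable : forall e e', ele e e' || ele e' e = (rng e == rng e') }.

Arguments src {S T o}.
Arguments rng {S T o}.
Arguments ele {S T o}.

Definition oiso (S T : finType) (F F' : oedges S T) : Prop :=
  exists h : F -> F',
    [/\ bijective h, forall e, src (h e) = src e, forall e, rng (h e) = rng e
      & forall e e', ele (h e) (h e') = ele e e'].

Section Composition.
Variables (S T U : finType) (F : oedges S T) (G : oedges T U).

Definition comp_edge : finType := {p : F * G | rng p.1 == src p.2}.

Definition comp_le : rel comp_edge := fun p q =>
  ((val p).2 != (val q).2) && ele (val p).2 (val q).2
  || ((val p).2 == (val q).2) && ele (val p).1 (val q).1.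

Fact comp_le_refl : reflexive comp_le.
Proof. by move=> p; rewrite /comp_le !eqxx /= ele_refl. Qed.

Fact comp_le_anti : antisymmetric comp_le.
Proof.
move=> p q; rewrite /comp_le => pq; apply: val_inj.
case: (val p) (val q) pq => [e g] [e' g'] /=.
rewrite (eq_sym g'); case: eqVneq => [<-|ne] /=; first by move/ele_anti ->.
by rewrite !orbF => /ele_anti E; rewrite E eqxx in ne.
Qed.

Fact comp_le_trans : transitive comp_le.
Proof.
move=> q p r; rewrite /comp_le.
case: (val p) (val q) (val r) => [e g] [e' g'] [e'' g''] /=.
case: (eqVneq g g') => [<-|gg'] /=.
  by case: (eqVneq g g'') => //= _; exact: ele_trans.
rewrite orbF => le1; case: (eqVneq g' g'') => [<-|g'g''] /=.
  by rewrite (negPf gg') le1.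
rewrite orbF => le2; rewrite (ele_trans le1 le2) andbT.
case: (eqVneq g g'') => //= E; rewrite -E in le2.
by rewrite (@ele_anti _ _ G g g') ?eqxx ?le1 // in gg'.
Qed.

Fact comp_le_comparable p q :
  comp_le p q || comp_le q p = (rng (val p).2 == rng (val q).2).
Proof.
rewrite /comp_le; case: p q => [[e g] /= eg] [[e' g'] /= eg'].
rewrite (eq_sym g'); case: eqVneq => [E|] /=.
  by rewrite ele_comparable (eqP eg) (eqP eg') E !eqxx.
by rewrite !orbF ele_comparable.
Qed.

Definition ocomp : oedges S U :=
  @OEdges S U comp_edge (fun p => src (val p).1) (fun p => rng (val p).2)
    comp_le comp_le_refl comp_le_anti comp_le_trans comp_le_comparable.

End Composition.

Section IsoTheory.

Lemma oiso_of (S T : finType) (F F' : oedges S T) (h : F -> F') (k : F' -> F) :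
  cancel h k -> cancel k h -> (forall e, src (h e) = src e) ->
  (forall e, rng (h e) = rng e) -> (forall e e', ele (h e) (h e') = ele e e') ->
  oiso F F'.
Proof. by move=> hk kh hs hr hl; exists h; split => //; exists k. Qed.

Lemma oiso_refl (S T : finType) (F : oedges S T) : oiso F F.
Proof. by apply: (@oiso_of _ _ _ _ id id). Qed.

Lemma oiso_sym (S T : finType) (F F' : oedges S T) : oiso F F' -> oiso F' F.
Proof.
case=> h [[k hk kh] hs hr hl]; apply: (@oiso_of _ _ _ _ k h) => // [e|e|e e'].
- by rewrite -hs kh.
- by rewrite -hr kh.
- by rewrite -hl !kh.
Qed.

Lemma oiso_trans (S T : finType) (F2 F1 F3 : oedges S T) :
  oiso F1 F2 -> oiso F2 F3 -> oiso F1 F3.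
Proof.
case=> h [bh hs hr hl] [k [bk ks kr kl]]; exists (k \o h); split.
- exact: bij_comp.
- by move=> e /=; rewrite ks hs.
- by move=> e /=; rewrite kr hr.
- by move=> e e' /=; rewrite kl hl.
Qed.

Lemma ocomp_congr (S T U : finType) (F F' : oedges S T) (G G' : oedges T U) :
  oiso F F' -> oiso G G' -> oiso (ocomp F G) (ocomp F' G').
Proof.
case=> h [[h' hK h'K] hs hr hl] [k [[k' kK k'K] ks kr kl]].
have h'r e : rng (h' e) = rng e by rewrite -hr h'K.
have k's e : src (k' e) = src e by rewrite -ks k'K.
have P1 (p : ocomp F G) : rng (h (val p).1) == src (k (val p).2).
  by rewrite hr ks; exact: valP p.
have P2 (p : ocomp F' G') : rng (h' (val p).1) == src (k' (val p).2).
  by rewrite h'r k's; exact: valP p.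
apply: (@oiso_of _ _ (ocomp F G) (ocomp F' G')
  (fun p => Sub (h (val p).1, k (val p).2) (P1 p) : ocomp F' G')
  (fun p => Sub (h' (val p).1, k' (val p).2) (P2 p) : ocomp F G)) => /=.
- by move=> p; apply: val_inj; rewrite /= hK kK -surjective_pairing.
- by move=> p; apply: val_inj; rewrite /= h'K k'K -surjective_pairing.
- by move=> p /=; rewrite hs.
- by move=> p /=; rewrite kr.
- by move=> p q; rewrite /comp_le /= kl hl (inj_eq (can_inj kK)).
Qed.

Lemma ocompA (S T U W : finType) (F : oedges S T) (G : oedges T U)
    (H : oedges U W) :
  oiso (ocomp F (ocomp G H)) (ocomp (ocomp F G) H).
Proof.
have Q1 (p : ocomp F (ocomp G H)) :
  rng (val p).1 == src (val (val p).2).1 by exact: valP p.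
pose i1 (p : ocomp F (ocomp G H)) : ocomp F G := Sub ((val p).1, (val (val p).2).1) (Q1 p).
have P1 (p : ocomp F (ocomp G H)) : rng (i1 p) == src (val (val p).2).2.
  exact: valP (val p).2.
have Q2 (p : ocomp (ocomp F G) H) :
  rng (val (val p).1).2 == src (val p).2 by exact: valP p.
pose i2 (p : ocomp (ocomp F G) H) : ocomp G H := Sub ((val (val p).1).2, (val p).2) (Q2 p).
have P2 (p : ocomp (ocomp F G) H) : rng (val (val p).1).1 == src (i2 p).
  exact: valP (val p).1.
apply: (@oiso_of _ _ (ocomp F (ocomp G H)) (ocomp (ocomp F G) H)
  (fun p => Sub (i1 p, (val (val p).2).2) (P1 p) : ocomp (ocomp F G) H)
  (fun p => Sub ((val (val p).1).1, i2 p) (P2 p) : ocomp F (ocomp G H))) => //=.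
- move=> [[e [[g h] gh]] eg]; apply: val_inj; congr pair.
  by apply: val_inj; reflexivity.
- move=> [[[[e g] gh] h] eg]; apply: val_inj => /=; congr pair.
  by apply: val_inj; reflexivity.
- move=> [[e [[g h] gh]] eg] [[e' [[g' h'] gh']] eg'].
  rewrite /comp_le /= -!val_eqE /= !xpair_eqE /comp_le /=.
  by case: (h == h'); case: (g == g'); rewrite /= ?andbF ?orbF ?andbT.
Qed.

End IsoTheory.

(* [obd_E n] is the edge set from level n to level n.+1, usually written
   E_{n+1}.  Comparable edges have the same range, hence the same level, so an
   order on the disjoint union of the edge sets is a family of levelwise ones. *)
Record obd := OBD {
  obd_V : nat -> finType;
  obd_E : forall n, oedges (obd_V n) (obd_V n.+1);
  obd_V0 : #|obd_V 0| = 1;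
  obd_V_gt0 : forall n, 0 < #|obd_V n|;
  obd_E_gt0 : forall n, 0 < #|obd_E n|;
  obd_src : forall n (v : obd_V n), exists e : obd_E n, src e = v;
  obd_rng : forall n (v : obd_V n.+1), exists e : obd_E n, rng e = v }.

Definition infinite_path (B : obd) (p : forall n, obd_E B n) : Prop :=
  forall n, rng (p n) = src (p n.+1).

Definition max_edge (S T : finType) (F : oedges S T) (e : F) : Prop :=
  forall e', ele e e' -> e' = e.

Definition min_edge (S T : finType) (F : oedges S T) (e : F) : Prop :=
  forall e', ele e' e -> e' = e.

Definition properly_ordered (B : obd) : Prop :=
  (exists! p : forall n, obd_E B n,
     infinite_path p /\ forall n, max_edge (p n)) /\
  (exists! p : forall n, obd_E B n,
     infinite_path p /\ forall n, min_edge (p n)).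

Section Segments.
Variable B : obd.
Notation V := (obd_V B).

(* One edge for each pair (v, w) in V_k x V_l such that v and w are the same
   element of the disjoint union of the V_n: if k = l this is one edge from v
   to v for each v in V_k, and otherwise there is no edge at all. *)
Definition diag_edge (k l : nat) : finType :=
  {p : V k * V l | Tagged V p.1 == Tagged V p.2}.

Fact diag_comparable k l (e e' : diag_edge k l) :
  (e == e') || (e' == e) = ((val e).2 == (val e').2).
Proof.
rewrite (eq_sym e') orbb -val_eqE.
case: e e' => [[v w] /= /eqP vw] [[v' w'] /= /eqP vw'].
rewrite xpair_eqE; case: (eqVneq w w') => [E|]; last by rewrite andbF.
move: vw'; rewrite -E -vw => /eqP; rewrite eq_Tagged /= => /eqP ->.
by rewrite eqxx.
Qed.

Definition diag (k l : nat) : oedges (V k) (V l) :=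
  @OEdges _ _ (diag_edge k l) (fun e => (val e).1) (fun e => (val e).2) eq_op
    (@eqxx _) (fun e e' ee' => eqP (proj1 (andP ee')))
    (fun e' e e'' ee' e'e'' => etrans (congr1 (eq_op^~ e'') (eqP ee')) e'e'')
    (@diag_comparable k l).

(* [segment k l] is E_{k,l}, computed up to isomorphism as
   E_{k,k} o E_{k+1} o ... o E_l; it has no edges when l < k. *)
Fixpoint segment (k l : nat) : oedges (V k) (V l) :=
  if l is m.+1 then
    if k <= m then ocomp (segment k m) (obd_E B m) else diag k m.+1
  else diag k 0.

Lemma segment_id k : segment k k = diag k k.
Proof. by case: k => //= k; rewrite ltnn. Qed.

Lemma segmentS k l : k <= l ->
  segment k l.+1 = ocomp (segment k l) (obd_E B l).
Proof. by move=> /= ->. Qed.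

Lemma diag_eq k (e : diag k k) : src e = rng e.
Proof. by case: e => [[v w]] /=; rewrite eq_Tagged /= => /eqP. Qed.

Lemma diag_val k (e : diag k k) : val e = (src e, src e).
Proof. by rewrite {2}diag_eq /= -surjective_pairing. Qed.

Definition diag_at k (v : V k) : diag k k := Sub (v, v) (eqxx (Tagged V v)).

Lemma diag_atE k (e : diag k k) v : src e = v -> e = diag_at v.
Proof. by move=> <-; apply: val_inj; exact: diag_val. Qed.

Lemma ocomp_diagr (S : finType) k (F : oedges S (V k)) :
  oiso (ocomp F (diag k k)) F.
Proof.
have P (e : F) : rng e == src (diag_at (rng e)) by [].
apply: (@oiso_of _ _ (ocomp F (diag k k)) F (fun p => (val p).1)
  (fun e => Sub (e, diag_at (rng e)) (P e) : ocomp F (diag k k))) => //=.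
- move=> [[e g] /= eg]; apply: val_inj; congr pair.
  by apply/esym/diag_atE; rewrite (eqP eg).
- by move=> [[e g] /= eg]; apply: etrans (eqP eg) (diag_eq g).
- move=> [[e g] /= eg] [[e' g'] /= eg']; rewrite /comp_le /=.
  case: (eqVneq g g') => //= ne; apply/negbTE/negP => le.
  have E : rng e == rng e' by rewrite -ele_comparable le.
  case/eqP: ne; rewrite (diag_atE (esym (eqP eg))) (eqP E).
  by apply/esym/diag_atE; rewrite (eqP eg').
Qed.

Lemma ocomp_diagl (T : finType) k (F : oedges (V k) T) :
  oiso (ocomp (diag k k) F) F.
Proof.
have P (e : F) : rng (diag_at (src e)) == src e by [].
apply: (@oiso_of _ _ (ocomp (diag k k) F) F (fun p => (val p).2)
  (fun e => Sub (diag_at (src e), e) (P e) : ocomp (diag k k) F)) => //=.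
- move=> [[g e] /= ge]; apply: val_inj; congr pair.
  by apply/esym/diag_atE; exact: etrans (diag_eq g) (eqP ge).
- by move=> [[g e] /= ge]; apply: esym (etrans (diag_eq g) (eqP ge)).
- move=> [[g e] /= ge] [[g' e'] /= ge']; rewrite /comp_le /=.
  case: (eqVneq e e') => //= E; last by rewrite orbF.
  have gg' : g = g'.
    apply: etrans (diag_atE (erefl _)) _; apply/esym/diag_atE.
    apply: etrans (diag_eq g') _; apply: etrans (eqP ge') _; rewrite -E.
    exact: etrans (esym (eqP ge)) (esym (diag_eq g)).
  by rewrite gg' eqxx E ele_refl.
Qed.

Lemma segment_cat k l m : k <= l -> l <= m ->
  oiso (ocomp (segment k l) (segment l m)) (segment k m).
Proof.
move=> kl; elim: m => [|m IH] lm.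
  move: lm kl; rewrite leqn0 => /eqP ->; rewrite leqn0 => /eqP ->.
  exact: ocomp_diagr.
move: lm; rewrite leq_eqVlt => /orP[/eqP <-|]; last rewrite ltnS => lm.
  by rewrite (segment_id l); exact: ocomp_diagr.
rewrite !segmentS // ?(leq_trans kl) //.
apply: oiso_trans (ocompA _ _ _) _.
by apply: ocomp_congr (IH lm) _; exact: oiso_refl.
Qed.

Lemma segment1 n : oiso (segment n n.+1) (obd_E B n).
Proof. by rewrite segmentS // segment_id; exact: ocomp_diagl. Qed.

End Segments.

Record premorphism (B C : obd) := Premorphism {
  pm_idx : nat -> nat;
  pm_edges : forall n, oedges (obd_V B n) (obd_V C (pm_idx n));
  pm_idx0 : pm_idx 0 = 0;
  pm_idx_mono : forall n, pm_idx n <= pm_idx n.+1;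
  pm_idx_unbounded : forall N, exists n, N < pm_idx n;
  pm_gt0 : forall n, 0 < #|pm_edges n|;
  pm_src : forall n v, exists e : pm_edges n, src e = v;
  pm_rng : forall n w, exists e : pm_edges n, rng e = w;
  pm_edges0 : #|pm_edges 0| = 1;
  pm_comm : forall n,
    oiso (ocomp (obd_E B n) (pm_edges n.+1))
         (ocomp (pm_edges n) (segment C (pm_idx n) (pm_idx n.+1))) }.

Lemma pm_idx_homo (B C : obd) (f : premorphism B C) k l :
  k <= l -> pm_idx f k <= pm_idx f l.
Proof. exact: (homo_leq leqnn leq_trans (pm_idx_mono f)). Qed.

Lemma pm_comm_segment (B C : obd) (f : premorphism B C) k l : k <= l ->
  oiso (ocomp (segment B k l) (pm_edges f l))
       (ocomp (pm_edges f k) (segment C (pm_idx f k) (pm_idx f l))).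
Proof.
elim: l => [|l IH].
  rewrite leqn0 => /eqP ->; rewrite !segment_id.
  by apply: oiso_trans (ocomp_diagl _) _; apply: oiso_sym; exact: ocomp_diagr.
rewrite leq_eqVlt => /orP[/eqP ->|]; last rewrite ltnS => kl.
  rewrite !segment_id.
  by apply: oiso_trans (ocomp_diagl _) _; apply: oiso_sym; exact: ocomp_diagr.
rewrite segmentS //.
apply: oiso_trans (oiso_sym (ocompA _ _ _)) _.
apply: oiso_trans (ocomp_congr (oiso_refl _) (pm_comm f l)) _.
apply: oiso_trans (ocompA _ _ _) _.
apply: oiso_trans (ocomp_congr (IH kl) (oiso_refl _)) _.
apply: oiso_trans (oiso_sym (ocompA _ _ _)) _.
apply: ocomp_congr (oiso_refl _) _.
by apply: segment_cat; [exact: pm_idx_homo | exact: pm_idx_mono].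
Qed.

Section IdPremorphism.
Variable B : obd.

Fact id_src n v : exists e : segment B n n, src e = v.
Proof.
rewrite segment_id; have P : Tagged (obd_V B) v == Tagged (obd_V B) v by [].
by exists (Sub (v, v) P).
Qed.

Fact id_rng n v : exists e : segment B n n, rng e = v.
Proof.
have [e <-] := id_src v; exists e.
by move: e; rewrite segment_id => e; rewrite diag_eq.
Qed.

Fact id_gt0 n : 0 < #|segment B n n|.
Proof.
have /card_gt0P[v _] := obd_V_gt0 B n.
by have [e _] := id_src v; apply/card_gt0P; exists e.
Qed.

Fact id_edges0 : #|segment B 0 0| = 1.
Proof.
have /fintype_le1P V1 : #|obd_V B 0| <= 1 by rewrite obd_V0.
apply/eqP; rewrite eqn_leq id_gt0 andbT; apply/fintype_le1P => e e'.
by apply: val_inj; rewrite /= (diag_val e) (diag_val e') (V1 (src e) (src e')).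
Qed.

Fact id_comm n :
  oiso (ocomp (obd_E B n) (segment B n.+1 n.+1))
       (ocomp (segment B n n) (segment B n n.+1)).
Proof.
rewrite !segment_id; apply: oiso_trans (ocomp_diagr _) _.
apply: oiso_sym; apply: oiso_trans (ocomp_diagl _) _; exact: segment1.
Qed.

Definition id_premorphism : premorphism B B :=
  @Premorphism B B id (fun n => segment B n n) erefl leqnSn
    (fun N => ex_intro _ N.+1 (ltnSn N)) id_gt0 id_src id_rng id_edges0 id_comm.

End IdPremorphism.

Section CompPremorphism.
Variables (B C D : obd) (f : premorphism B C) (g : premorphism C D).

Let h n := pm_idx g (pm_idx f n).
Let H n : oedges (obd_V B n) (obd_V D (h n)) :=
  ocomp (pm_edges f n) (pm_edges g (pm_idx f n)).

Fact comp_idx0 : h 0 = 0.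
Proof. by rewrite /h !pm_idx0. Qed.

Fact comp_idx_mono n : h n <= h n.+1.
Proof. by apply: pm_idx_homo; exact: pm_idx_mono. Qed.

Fact comp_idx_unbounded N : exists n, N < h n.
Proof.
have [m Nm] := pm_idx_unbounded g N; have [n mn] := pm_idx_unbounded f m.
by exists n; apply: leq_trans Nm _; apply: pm_idx_homo; exact: ltnW.
Qed.

Fact comp_src n v : exists e : H n, src e = v.
Proof.
have [e <-] := @pm_src _ _ f n v.
have [e' /esym/eqP ee'] := @pm_src _ _ g _ (rng e).
by exists (Sub (e, e') ee' : ocomp _ _).
Qed.

Fact comp_rng n w : exists e : H n, rng e = w.
Proof.
have [e' <-] := @pm_rng _ _ g _ w.
have [e /eqP ee'] := @pm_rng _ _ f n (src e').
by exists (Sub (e, e') ee' : ocomp _ _).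
Qed.

Fact comp_gt0 n : 0 < #|H n|.
Proof.
have /card_gt0P[v _] := obd_V_gt0 B n.
by have [e _] := comp_src v; apply/card_gt0P; exists e.
Qed.

Fact comp_edges0 : #|H 0| = 1.
Proof.
apply/eqP; rewrite eqn_leq comp_gt0 andbT.
apply: leq_trans (leq_card val val_inj) _.
by rewrite card_prod pm_edges0 mul1n pm_idx0 pm_edges0.
Qed.

Fact comp_comm n :
  oiso (ocomp (obd_E B n) (H n.+1)) (ocomp (H n) (segment D (h n) (h n.+1))).
Proof.
apply: oiso_trans (ocompA _ _ _) _.
apply: oiso_trans (ocomp_congr (pm_comm f n) (oiso_refl _)) _.
apply: oiso_trans (oiso_sym (ocompA _ _ _)) _.
apply: oiso_trans
  (ocomp_congr (oiso_refl _) (pm_comm_segment g (pm_idx_mono f n))) _.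
exact: ocompA.
Qed.

Definition comp_premorphism : premorphism B D :=
  @Premorphism B D h H comp_idx0 comp_idx_mono comp_idx_unbounded
    comp_gt0 comp_src comp_rng comp_edges0 comp_comm.

End CompPremorphism.

Definition premorphism_equiv (B C : obd) (f g : premorphism B C) : Prop :=
  exists n m : nat -> nat,
    0 < n 0 /\
    forall k,
      [/\ n k < m k < n k.+1,
          pm_idx f (n k) < pm_idx g (m k) < pm_idx f (n k.+1),
          oiso (ocomp (segment B (n k) (m k)) (pm_edges g (m k)))
               (ocomp (pm_edges f (n k))
                      (segment C (pm_idx f (n k)) (pm_idx g (m k))))
        & oiso (ocomp (segment B (m k) (n k.+1)) (pm_edges f (n k.+1)))
               (ocomp (pm_edges g (m k))
                      (segment C (pm_idx g (m k)) (pm_idx f (n k.+1))))].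

Section Equivalence.
Variables B C : obd.
Implicit Types f g h : premorphism B C.

Let linked f g a b :=
  [/\ a < b, pm_idx f a < pm_idx g b
    & oiso (ocomp (segment B a b) (pm_edges g b))
           (ocomp (pm_edges f a) (segment C (pm_idx f a) (pm_idx g b)))].

Let linked_trans f g h a b c :
  linked f g a b -> linked g h b c -> linked f h a c.
Proof.
move=> [ab fg i1] [bc gh i2]; split; [exact: ltn_trans bc|exact: ltn_trans gh|].
apply: oiso_trans (ocomp_congr (oiso_sym
  (segment_cat _ (ltnW ab) (ltnW bc))) (oiso_refl _)) _.
apply: oiso_trans (oiso_sym (ocompA _ _ _)) _.
apply: oiso_trans (ocomp_congr (oiso_refl _) i2) _.
apply: oiso_trans (ocompA _ _ _) _.
apply: oiso_trans (ocomp_congr i1 (oiso_refl _)) _.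
apply: oiso_trans (oiso_sym (ocompA _ _ _)) _.
by apply: ocomp_congr (oiso_refl _) _; apply: segment_cat; exact: ltnW.
Qed.

Let linked_widen f g a a' b : a' <= a -> linked f g a b -> linked f g a' b.
Proof.
move=> aa [ab fg i]; have faa := pm_idx_homo f aa.
split; [exact: leq_ltn_trans ab|exact: leq_ltn_trans fg|].
apply: oiso_trans (ocomp_congr (oiso_sym
  (segment_cat _ aa (ltnW ab))) (oiso_refl _)) _.
apply: oiso_trans (oiso_sym (ocompA _ _ _)) _.
apply: oiso_trans (ocomp_congr (oiso_refl _) i) _.
apply: oiso_trans (ocompA _ _ _) _.
apply: oiso_trans (ocomp_congr (pm_comm_segment f aa) (oiso_refl _)) _.
apply: oiso_trans (oiso_sym (ocompA _ _ _)) _.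
by apply: ocomp_congr (oiso_refl _) _; apply: segment_cat => //; exact: ltnW.
Qed.

Let linkedP f g : premorphism_equiv f g <->
  (forall a, exists b, linked f g a b) /\ (forall b, exists a, linked g f b a).
Proof.
split=> [[n [m [_ nm]]]|[/choice[t tP] /choice[u uP]]].
  have n_ge k : k <= n k.
    elim: k => // k IH; have [/andP[lt1 lt2] _ _ _] := nm k.
    exact: leq_ltn_trans IH (ltn_trans lt1 lt2).
  split=> a; have [/andP[lt1 lt2] /andP[lt3 lt4] i1 i2] := nm a.
    by exists (m a); apply: linked_widen (n_ge a) _.
  exists (n a.+1); apply: (@linked_widen _ _ (m a)) => //.
  exact: leq_trans (n_ge a) (ltnW lt1).
pose n k := iter k (u \o t) 1; exists n, (t \o n); split => // k /=.
have [lt1 lt2 i1] := tP (n k); have [lt3 lt4 i2] := uP (t (n k)).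
by split=> //; [rewrite lt1 lt3|rewrite lt2 lt4].
Qed.

Lemma premorphism_equiv_refl f : premorphism_equiv f f.
Proof.
have fP a : exists b, linked f f a b.
  have [n fn] := pm_idx_unbounded f (pm_idx f a).
  exists n; have an : a < n.
    by rewrite ltnNge; apply/negP => /(pm_idx_homo f); rewrite leqNgt fn.
  by split=> //; apply: pm_comm_segment; exact: ltnW.
exact/linkedP.
Qed.

Lemma premorphism_equiv_sym f g :
  premorphism_equiv f g -> premorphism_equiv g f.
Proof. by move=> /linkedP[fg gf]; apply/linkedP. Qed.

Lemma premorphism_equiv_trans f g h :
  premorphism_equiv f g -> premorphism_equiv g h -> premorphism_equiv f h.
Proof.
move=> /linkedP[fg gf] /linkedP[gh hg]; apply/linkedP; split=> a.
  have [b ab] := fg a; have [c bc] := gh b.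
  by exists c; exact: linked_trans ab bc.
have [b ab] := hg a; have [c bc] := gf b.
by exists c; exact: linked_trans ab bc.
Qed.

(* The equivalence class of f.  The type [set (premorphism B C)] is not
   available: premorphisms live in too large a universe for [set]. *)
Definition premorphism_class f : premorphism B C -> Prop :=
  fun g => premorphism_equiv f g.

Lemma premorphism_classP f g :
  premorphism_class f = premorphism_class g <-> premorphism_equiv f g.
Proof.
split=> [E|fg].
  by rewrite -/(premorphism_class f g) E; exact: premorphism_equiv_refl.
apply/funext => h; apply/propext; split; last exact: premorphism_equiv_trans.
by apply: premorphism_equiv_trans; exact: premorphism_equiv_sym.
Qed.

End Equivalence.

(* The composite [g][f] is [gf], so this asks for mutually inverse morphisms. *)
Definition obd_isomorphic (B C : obd) : Prop :=
  exists (f : premorphism B C) (g : premorphism C B),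
    premorphism_class (comp_premorphism f g)
      = premorphism_class (id_premorphism B) /\
    premorphism_class (comp_premorphism g f)
      = premorphism_class (id_premorphism C).

Definition homeomorphism (X Y : topologicalType) (h : X -> Y) : Prop :=
  exists k : Y -> X, [/\ cancel h k, cancel k h, continuous h & continuous k].

Definition metrizable (R : realType) (X : topologicalType) : Prop :=
  exists (M : metricType R) (h : X -> M), homeomorphism h.

Definition closed_invariant (X : topologicalType) (phi : X -> X) (M : set X) :=
  [/\ M !=set0, closed M & phi @` M = M].

Definition minimal_subset (X : topologicalType) (phi : X -> X) (M : set X) :=
  closed_invariant phi M /\
  forall N : set X, closed_invariant phi N -> N `<=` M -> N = M.

Record em_system (R : realType) := EMSystem {
  em_space :> topologicalType;
  em_metrizable : metrizable R em_space;
  em_compact : compact [set: em_space];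
  em_disconnected : totally_disconnected [set: em_space];
  em_map : em_space -> em_space;
  em_homeo : homeomorphism em_map;
  em_minimal : exists! M, minimal_subset em_map M;
  em_pt : em_space;
  em_pt_minimal : exists2 M, minimal_subset em_map M & M em_pt }.

Section KakutaniRokhlin.
Variables (X : topologicalType) (phi : X -> X) (x0 : X).

(* [kr_tower k] is the sequence (Z(k,1), ..., Z(k,J(k))), so that Z(k,j) is
   [nth set0 (kr_tower k) j.-1].  Towers are pairwise distinct, being sequences
   of non-empty disjoint sets, so a tower can be identified with its index. *)
Record kr_partition := KRPartition {
  kr_num : nat;
  kr_tower : 'I_kr_num -> seq (set X);
  kr_tower_gt0 : forall k, 0 < size (kr_tower k);
  kr_clopen : forall k j, j < size (kr_tower k) ->
    clopen (nth set0 (kr_tower k) j);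
  kr_partitionP :
    partition [set kj : 'I_kr_num * nat | kj.2 < size (kr_tower kj.1)]
      (fun kj => nth set0 (kr_tower kj.1) kj.2) [set: X];
  kr_step : forall k j, j.+1 < size (kr_tower k) ->
    phi @` nth set0 (kr_tower k) j = nth set0 (kr_tower k) j.+1;
  kr_top_pt : (\bigcup_k last set0 (kr_tower k)) x0;
  kr_top_map :
    phi @` (\bigcup_k last set0 (kr_tower k)) = \bigcup_k head set0 (kr_tower k)
}.

Definition kr_height (P : kr_partition) (k : 'I_(kr_num P)) : nat :=
  size (kr_tower k).

Definition kr_level (P : kr_partition) (k : 'I_(kr_num P)) (j : nat) : set X :=
  nth set0 (kr_tower k) j.

Definition kr_top (P : kr_partition) : set X :=
  \bigcup_k last set0 (@kr_tower P k).

Definition kr_cells (P : kr_partition) : set (set X) :=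
  [set A | exists (k : 'I_(kr_num P)) j, j < kr_height k /\ A = kr_level k j].

Definition kr_refines (P Q : kr_partition) : Prop :=
  forall A, kr_cells Q A -> exists2 D, kr_cells P D & A `<=` D.

Lemma kr_height_gt0 (P : kr_partition) (k : 'I_(kr_num P)) : 0 < kr_height k.
Proof. exact: kr_tower_gt0. Qed.

Lemma kr_level_inj (P : kr_partition) (k k' : 'I_(kr_num P)) j j' x :
  j < kr_height k -> j' < kr_height k' -> kr_level k j x -> kr_level k' j' x ->
  k = k' /\ j = j'.
Proof.
move=> jk jk' kx kx'; have [_ tP _] := kr_partitionP P.
have [] : (k, j) = (k', j') by apply: tP => //; exists x.
by [].
Qed.

Lemma kr_level_neq0 (P : kr_partition) (k : 'I_(kr_num P)) j :
  j < kr_height k -> kr_level k j !=set0.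
Proof. by move=> jk; have [_ _ nP] := kr_partitionP P; exact: (nP (k, j)). Qed.

Lemma kr_level_cover (P : kr_partition) x :
  exists (k : 'I_(kr_num P)) j, j < kr_height k /\ kr_level k j x.
Proof.
have [cP _ _] := kr_partitionP P.
have [[k j] /= jk kx] : cover [set kj : 'I_(kr_num P) * nat |
    kj.2 < size (kr_tower kj.1)] (fun kj => nth set0 (kr_tower kj.1) kj.2) x.
  by rewrite cP.
by exists k, j.
Qed.

Lemma kr_last (P : kr_partition) (k : 'I_(kr_num P)) :
  last set0 (kr_tower k) = kr_level k (kr_height k).-1.
Proof. by rewrite /kr_level nth_last. Qed.

Lemma kr_head (P : kr_partition) (k : 'I_(kr_num P)) :
  head set0 (kr_tower k) = kr_level k 0.
Proof. by rewrite /kr_level nth0. Qed.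

(* Levels are numbered from 0, so the tower [T] of Q traverses the tower [S] of
   P from its level [k] on.  The bound on [k + j] is not redundant: beyond the
   height of [T], [kr_level T] is empty. *)
Definition kr_edge (P Q : kr_partition) (S : 'I_(kr_num P)) (T : 'I_(kr_num Q))
    (k : nat) : Prop :=
  forall j, j < kr_height S ->
    k + j < kr_height T /\ kr_level T (k + j) `<=` kr_level S j.

Section Edges.
Variables P Q : kr_partition.
Hypotheses (PQ : kr_refines P Q) (topPQ : kr_top Q `<=` kr_top P).

(* Triples (S, (T, k)); the tower S has at least one level, whence the
   restriction of k to values less than the height of T. *)
Definition kr_edge_type : finType :=
  {e : 'I_(kr_num P) * {T : 'I_(kr_num Q) & 'I_(kr_height T)} |
    `[< kr_edge e.1 (tag e.2) (tagged e.2) >]}.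

Definition kr_edge_le : rel kr_edge_type := fun e e' =>
  (tag (val e).2 == tag (val e').2) &&
  (tagged (val e).2 <= tagged (val e').2).

Fact kr_edge_le_refl : reflexive kr_edge_le.
Proof. by move=> e; rewrite /kr_edge_le eqxx leqnn. Qed.

Fact kr_edge_le_trans : transitive kr_edge_le.
Proof.
move=> e' e e'' /andP[/eqP E le1] /andP[/eqP E' le2].
by apply/andP; split; [apply/eqP; exact: etrans E'|exact: leq_trans le2].
Qed.

Fact kr_edge_le_anti : antisymmetric kr_edge_le.
Proof.
move=> e e' /andP[/andP[/eqP E le1] /andP[_ le2]]; apply: val_inj.
have {le1 le2} := anti_leq (introT andP (conj le1 le2)).
case: e e' E => [[S [T k]] /= /asboolP ek] [[S' [T' k']] /= /asboolP ek'] E.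
case: T' / E k' ek' => k' ek' /val_inj kk'; rewrite -kk' in ek' *.
have [kT sub] := ek 0 (kr_height_gt0 S).
have [_ sub'] := ek' 0 (kr_height_gt0 S').
have [x Tx] := kr_level_neq0 kT.
by have [-> _] := kr_level_inj (kr_height_gt0 S) (kr_height_gt0 S')
  (sub _ Tx) (sub' _ Tx).
Qed.

Fact kr_edge_le_comparable e e' : kr_edge_le e e' || kr_edge_le e' e =
  (tag (val e).2 == tag (val e').2).
Proof.
rewrite /kr_edge_le (eq_sym (tag (val e').2)).
by case: eqP => //= _; exact: leq_total.
Qed.

Definition kr_edges : oedges 'I_(kr_num P) 'I_(kr_num Q) :=
  @OEdges _ _ kr_edge_type (fun e => (val e).1) (fun e => tag (val e).2)
    kr_edge_le kr_edge_le_refl kr_edge_le_anti kr_edge_le_trans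
    kr_edge_le_comparable.

Let kr_refine_level (S : 'I_(kr_num P)) (T : 'I_(kr_num Q)) j k x :
  j < kr_height S -> k < kr_height T -> kr_level S j x -> kr_level T k x ->
  kr_level T k `<=` kr_level S j.
Proof.
move=> jS kT Sx Tx.
have [|_ [S' [j' [jS' ->]]] sub] := PQ (A := kr_level T k); first by exists T, k.
by have [-> ->] := kr_level_inj jS jS' Sx (sub _ Tx).
Qed.

Let kr_edge_start (S : 'I_(kr_num P)) (T : 'I_(kr_num Q)) k :
  k < kr_height T -> kr_level T k `<=` kr_level S 0 -> kr_edge S T k.
Proof.
move=> kT sub; elim=> [|j IH] jS; first by rewrite addn0.
have [kjT subj] := IH (ltnW jS).
have kjT' : (k + j).+1 < kr_height T.
  rewrite ltn_neqAle kjT andbT; apply/eqP => top.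
  have [x Tx] := kr_level_neq0 kjT.
  have [S' _] : kr_top P x.
    by apply: topPQ; exists T => //; rewrite kr_last -top.
  rewrite kr_last => S'x.
  have S'lt : (kr_height S').-1 < kr_height S' by rewrite prednK ?kr_height_gt0.
  have [E jE] := kr_level_inj (ltnW jS) S'lt (subj _ Tx) S'x.
  by move: jS; rewrite jE -E prednK ?kr_height_gt0 // ltnn.
rewrite addnS; split=> //.
by rewrite /kr_level -!kr_step //; exact: image_subset.
Qed.

Let kr_edge_sub (S : 'I_(kr_num P)) (T : 'I_(kr_num Q)) k :
  k < kr_height T -> kr_level T k `<=` kr_level S 0 ->
  exists2 e : kr_edges, src e = S & rng e = T.
Proof.
move=> kT /(kr_edge_start kT) e.
have e' : `[< kr_edge (S, Tagged (fun T => 'I_(kr_height T)) (Ordinal kT)).1 T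
                (Ordinal kT) >] by apply/asboolP.
by exists (Sub (S, Tagged (fun T => 'I_(kr_height T)) (Ordinal kT)) e').
Qed.

Lemma kr_edges_src (S : 'I_(kr_num P)) : exists e : kr_edges, src e = S.
Proof.
have [x Sx] := kr_level_neq0 (kr_height_gt0 S).
have [T [k [kT Tx]]] := kr_level_cover Q x.
have sub := kr_refine_level (kr_height_gt0 S) kT Sx Tx.
by have [e eS _] := kr_edge_sub kT sub; exists e.
Qed.

Lemma kr_edges_rng (T : 'I_(kr_num Q)) : exists e : kr_edges, rng e = T.
Proof.
have T0 := kr_height_gt0 T; have [x Tx] := kr_level_neq0 T0.
have [y Qy yx] : (phi @` kr_top Q) x.
  by rewrite kr_top_map; exists T => //; rewrite kr_head.
have [S _] : (\bigcup_k head set0 (@kr_tower P k)) x.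
  by rewrite -kr_top_map; exists y => //; exact: topPQ.
rewrite kr_head => Sx.
have sub := kr_refine_level (kr_height_gt0 S) T0 Sx Tx.
by have [e _ eT] := kr_edge_sub T0 sub; exists e.
Qed.

Lemma kr_edges_gt0 : 0 < #|kr_edges|.
Proof.
have [T _ _] := kr_top_pt Q.
by have [e _] := kr_edges_rng T; apply/card_gt0P; exists e.
Qed.

End Edges.

Lemma kr_num_gt0 (P : kr_partition) : 0 < #|'I_(kr_num P)|.
Proof. by have [T _ _] := kr_top_pt P; apply/card_gt0P; exists T. Qed.

Lemma kr_num1 (P : kr_partition) :
  kr_cells P = [set setT] -> #|'I_(kr_num P)| = 1.
Proof.
move=> PT; apply/eqP; rewrite eqn_leq kr_num_gt0 andbT.
have all_x0 (k : 'I_(kr_num P)) : kr_level k 0 x0.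
  have : kr_cells P (kr_level k 0) by exists k, 0; split=> //; exact: kr_height_gt0.
  by rewrite PT => ->.
apply/fintype_le1P => k k'.
by have [] := kr_level_inj (kr_height_gt0 k') (kr_height_gt0 k)
  (all_x0 k') (all_x0 k).
Qed.

Lemma kr_topT (P : kr_partition) : kr_cells P = [set setT] -> kr_top P = setT.
Proof.
move=> PT; have [k _] := kr_top_pt P; rewrite kr_last => _.
have : kr_cells P (kr_level k (kr_height k).-1).
  by exists k, (kr_height k).-1; rewrite prednK ?kr_height_gt0.
rewrite PT => kT; apply/seteqP; split=> // x _.
by exists k => //; rewrite kr_last kT.
Qed.

End KakutaniRokhlin.

Record SDS (R : realType) := MkSDS {
  sds_sys :> em_system R;
  sds_part : nat -> kr_partition (@em_map R sds_sys) (em_pt sds_sys);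
  sds_part0 : kr_cells (sds_part 0) = [set setT];
  sds_refine : forall n, kr_refines (sds_part n) (sds_part n.+1);
  sds_top_decr : forall n, kr_top (sds_part n.+2) `<=` kr_top (sds_part n.+1);
  sds_top_cap : \bigcap_n kr_top (sds_part n.+1) = [set em_pt sds_sys];
  sds_basis : basis (\bigcup_n kr_cells (sds_part n)) }.

Section FunctorP.
Variables (R : realType) (X : SDS R).

Lemma sds_top n : kr_top (sds_part X n.+1) `<=` kr_top (sds_part X n).
Proof.
by case: n => [|n]; [rewrite (kr_topT (sds_part0 X)) | exact: sds_top_decr].
Qed.

Definition P_obj : obd :=
  @OBD (fun n => 'I_(kr_num (sds_part X n)))
    (fun n => kr_edges (sds_part X n) (sds_part X n.+1))
    (kr_num1 (sds_part0 X))
    (fun n => kr_num_gt0 (sds_part X n))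
    (fun n => kr_edges_gt0 (@sds_refine R X n) (@sds_top n))
    (fun n => kr_edges_src (@sds_refine R X n) (@sds_top n))
    (fun n => kr_edges_rng (@sds_refine R X n) (@sds_top n)).

End FunctorP.

(* Main.v *)
Require Import Defs.
From HB Require Import structures.
From mathcomp Require Import all_boot all_order all_algebra.
From mathcomp Require Import all_classical all_reals all_analysis.

Set Implicit Arguments.
Unset Strict Implicit.
Unset Printing Implicit Defensive.

Import Order.TTheory GRing.Theory Num.Theory.

Local Open Scope classical_set_scope.

(** The maximal edges of a diagram define a map from the vertices of each level
    to those of the preceding one, sending a vertex to the source of the maximal
    edge into it; infinite paths of maximal edges are the threads of the inverse
    system of these maps, and the same holds for minimal edges.  Taking extremal
    edges is compatible with composition of ordered edge sets, because the order
    of a composite is lexicographic ([ext_ocompP]).  Hence a premorphism sends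
    threads to threads, equivalent premorphisms do so in the same way, and having
    exactly one extremal thread is invariant under isomorphism
    ([uniq_ethread_iso]).  In the diagram of a system, a thread of maximal edges
    is a sequence of towers whose top levels decrease; their intersection is not
    empty by compactness and the tops of the partitions shrink to the
    distinguished point, so there is exactly one thread; bottom levels are the
    images of top levels ([P_obj_uniq_ethread]).

    Conversely, let the diagram be properly ordered.  Its infinite paths form an
    inverse limit of finite sets, which is a compact, totally disconnected metric
    space.  The Vershik map sends a path to its successor, and the maximal path
    to the minimal one.  It is obtained from relations between paths of a given
    finite length: [a] is related to [b] if [b] is the next path with the same
    range, or if [a] is maximal and [b] is minimal.  These relations are total in
    both directions and compatible with truncation ([step_trunc]), and by the
    uniqueness of the extremal paths they determine the image of an infinite path
    ([step_uniq]); a compactness argument then yields a continuous map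
    ([ilim_graph]) and, exchanging the two directions, its inverse ([vershik]).
    The cylinders of the paths of length [n], grouped by range and listed in
    order, form a Kakutani-Rokhlin partition whose top consists of the infinite
    paths that are maximal up to level [n].  A non-empty closed invariant set
    meets all these tops, so it contains the maximal path
    ([closed_invariant_xmax]), which gives the unique minimal set.  Finally, an edge of the diagram corresponds to
    a passage of one tower through another, and so the diagram of the system is
    levelwise isomorphic to the original one ([path_level_iso]). *)

(** * Extremal edges and positions in an ordered edge set *)

Section Extremal.
Variables (S T : finType) (F : oedges S T).
Implicit Types (e : F) (b : bool).

(** The order of [F] if [b] is true and the reverse order otherwise; this treats
    maximal and minimal edges at once. *)
Definition ole b e e' : bool := if b then ele e e' else ele e' e.

(** A maximal edge if [b] is true and a minimal edge otherwise. *)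
Definition ext_edge b e : Prop := forall e', ole b e e' -> e' = e.

Lemma ole_refl b : reflexive (ole b).
Proof. by case: b => e; exact: ele_refl. Qed.

Lemma ole_anti b : antisymmetric (ole b).
Proof. by case: b => e e' /= h; apply: ele_anti; rewrite // andbC. Qed.

Lemma ole_trans b : transitive (ole b).
Proof.
case: b => e' e e'' /= h1 h2; first exact: ele_trans h1 h2.
exact: ele_trans h2 h1.
Qed.

Lemma ole_comparable b e e' : ole b e e' || ole b e' e = (rng e == rng e').
Proof. by case: b => /=; rewrite -ele_comparable // orbC. Qed.

Lemma ole_rng b e e' : ole b e e' -> rng e = rng e'.
Proof. by move=> h; apply/eqP; rewrite -(ole_comparable b) h. Qed.

Lemma ext_edge_uniq b e e' :
  ext_edge b e -> ext_edge b e' -> rng e = rng e' -> e = e'.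
Proof.
by move=> xe xe' /eqP; rewrite -(ole_comparable b) => /orP[/xe|/xe'].
Qed.

Lemma ext_edge_exists b t :
  (exists e : F, rng e = t) -> exists2 e, ext_edge b e & rng e = t.
Proof.
(* An edge with the largest number of edges before it is extremal. *)
case=> e0 e0t; pose w e := #|[pred c | ole b c e]|.
have : rng e0 == t by apply/eqP.
case/(@arg_maxnP _ e0 (fun e => rng e == t) w) => e et emax.
exists e; last exact/eqP.
move=> e' ee'; apply/eqP; apply: contraT => ne.
have := emax e'; rewrite -(ole_rng ee') => /(_ et); rewrite /= leqNgt => /negP[].
apply: proper_card; apply/properP; split.
  by apply/fintype.subsetP => c; rewrite !inE => ce; exact: ole_trans ce ee'.
exists e'; rewrite !inE ?ole_refl //; apply: contra ne => e'e.
by apply/eqP; apply: (@ole_anti b); rewrite e'e.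
Qed.

(** The number of elements strictly below [e] in its fibre. *)
Definition pos e : nat := #|[pred c | ele c e && (c != e)]|.

(** The number of edges with range [t]. *)
Definition fib_size (t : T) : nat := #|[pred e : F | rng e == t]|.

Lemma pos_lt e e' : ele e e' -> e != e' -> pos e < pos e'.
Proof.
move=> ee' ne; apply: proper_card; apply/properP; split.
  apply/fintype.subsetP => c; rewrite !inE => /andP[ce cne].
  rewrite (ele_trans ce ee') /=; apply: contra cne => /eqP ce'.
  by apply/eqP; apply: ele_anti; rewrite ce ce' ee'.
by exists e; rewrite !inE ?ee' ?ne // eqxx andbF.
Qed.

Lemma ele_pos e e' : rng e = rng e' -> ele e e' = (pos e <= pos e').
Proof.
move=> r; case: (eqVneq e e') => [->|ne]; first by rewrite ele_refl leqnn.
have /orP[h|h] : ele e e' || ele e' e by rewrite ele_comparable r.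
  by rewrite h ltnW // pos_lt.
have lt : pos e' < pos e by apply: pos_lt; rewrite // eq_sym.
rewrite leqNgt lt; apply/negbTE/negP => h'; case/eqP: ne.
by apply: ele_anti; rewrite h h'.
Qed.

Lemma pos_inj e e' : rng e = rng e' -> pos e = pos e' -> e = e'.
Proof.
move=> r p; apply: ele_anti.
by rewrite (ele_pos r) (ele_pos (esym r)) p leqnn.
Qed.

Lemma pos_bound e : pos e < fib_size (rng e).
Proof.
apply: proper_card; apply/properP; split.
  apply/fintype.subsetP => c; rewrite !inE => /andP[ce _].
  by rewrite -ele_comparable ce.
by exists e; rewrite !inE ?eqxx // andbF.
Qed.

(** Positions embed the fibre of [t] into [0, fib_size t), a set of the same
    cardinality. *)
Lemma pos_surj t j : j < fib_size t -> exists2 e : F, rng e = t & pos e = j.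
Proof.
move=> jt; pose U : finType := {e : F | rng e == t}.
have ub (u : U) : pos (val u) < fib_size t.
  have := pos_bound (val u); have /eqP -> // := valP u.
pose h (u : U) : 'I_(fib_size t) := Ordinal (ub u).
have hinj : injective h.
  move=> u v /(congr1 val) /= p; apply/val_inj/pos_inj => //.
  exact: etrans (eqP (valP u)) (esym (eqP (valP v))).
have /(inj_card_onto hinj)/(_ (Ordinal jt)) : #|'I_(fib_size t)| <= #|U|.
  by rewrite card_ord card_sig.
case/codomP => u /(congr1 val) /= p.
by exists (val u); [exact/eqP/(valP u)|].
Qed.

Lemma min_edge_pos e : ext_edge false e <-> pos e = 0.
Proof.
split=> [xe|p e' /= e'e].
  have [e' r p] := @pos_surj (rng e) 0 (leq_ltn_trans (leq0n _) (pos_bound e)).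
  by rewrite -(xe e') //= (ele_pos r) p.
have r : rng e' = rng e := ole_rng (b := true) e'e.
apply/pos_inj => //.
by move: e'e; rewrite ele_pos // p leqn0 => /eqP.
Qed.

Lemma max_edge_pos e : ext_edge true e <-> (pos e).+1 = fib_size (rng e).
Proof.
split=> [xe|p e' /= ee'].
  apply/eqP; rewrite eqn_leq pos_bound leqNgt; apply/negP => /pos_surj[e' r p].
  have ee' : ele e e' by rewrite ele_pos // p.
  by move: p; rewrite (xe e' ee') => /eqP; rewrite ltn_eqF.
have r := ole_rng (b := true) ee'; apply/pos_inj => //.
apply/eqP; rewrite eqn_leq -(ele_pos r) ee' andbT -ltnS p r.
exact: pos_bound.
Qed.

(** If [b] is true, [e'] is the successor of [e] in its fibre; otherwise it is
    the predecessor. *)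
Definition next_edge b e e' : Prop :=
  rng e = rng e' /\ if b then pos e' = (pos e).+1 else pos e = (pos e').+1.

Lemma next_edge_uniq b e e1 e2 : next_edge b e e1 -> next_edge b e e2 -> e1 = e2.
Proof.
move=> [r1 p1] [r2 p2]; apply: pos_inj; first by rewrite -r1.
by case: b p1 p2 => [-> ->//|-> [->]].
Qed.

Lemma next_edge_ext b e e' : next_edge b e e' -> ~ ext_edge b e.
Proof.
case: b => [[r p]|[r p]]; last by move/min_edge_pos; rewrite p.
by move/max_edge_pos; rewrite -p r => e'b; have := pos_bound e'; rewrite -e'b ltnn.
Qed.

Lemma next_edge_exists b e : ~ ext_edge b e -> exists e', next_edge b e e'.
Proof.
case: b => [nx|/min_edge_pos/eqP].
  have : (pos e).+1 < fib_size (rng e).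
    rewrite ltn_neqAle pos_bound andbT; apply/eqP.
    by apply: contra_not nx => /max_edge_pos.
  by case/pos_surj => e' r p; exists e'; split.
rewrite -lt0n => e0; have : (pos e).-1 < fib_size (rng e).
  exact: leq_ltn_trans (leq_pred _) (pos_bound e).
by case/pos_surj => e' r p; exists e'; split; rewrite //= p prednK.
Qed.

(** Being consecutive, in terms of the order alone. *)
Lemma next_edgeP b e e' : next_edge b e e' <->
  [/\ ole b e e', e != e'
    & forall c, ole b e c -> ole b c e' -> c = e \/ c = e'].
Proof.
wlog {b} : b e e' / b = true; last move=> ->.
  move=> hw; have {}hw := hw true _ _ erefl.
  case: b; first exact: hw.
  have fl : next_edge false e e' <-> next_edge true e' e.
    by split=> -[r p]; split.
  split=> [/fl/hw[h1 h2 h3]|[h1 h2 h3]].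
    split=> // [|c c1 c2]; first by rewrite eq_sym.
    by have [] := h3 c; [| |right|left].
  apply/fl/hw; split=> // [|c c1 c2]; first by rewrite eq_sym.
  by have [] := h3 c; [| |right|left].
split=> [[r p]|[h ne hc]].
  split=> [||c /= ec ce']; first by rewrite /= ele_pos // p.
    by apply/eqP => ee'; move: p; rewrite ee' => /eqP; rewrite ltn_eqF.
  have r1 := ole_rng (b := true) ec; have r2 := ole_rng (b := true) ce'.
  move: ec ce'; rewrite (ele_pos r1) (ele_pos r2) p leq_eqVlt.
  case/orP => [/eqP pe _|lt1 lt2]; [left|right]; apply/pos_inj => //.
  by apply/eqP; rewrite eqn_leq p lt1 lt2.
have r := ole_rng h; split=> //; apply/eqP.
rewrite eqn_leq (pos_lt h ne) andbT leqNgt; apply/negP => lt.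
have [c rc pc] := pos_surj (ltn_trans lt (pos_bound e')).
have ec : ole true e c by rewrite /= ele_pos ?rc // pc.
have ce' : ole true c e' by rewrite /= ele_pos // pc ltnW.
have [E|E] := hc c ec ce'; last by rewrite -E pc ltnn in lt.
by move: pc; rewrite E => /eqP; rewrite ltn_eqF.
Qed.

End Extremal.

Lemma ole_iso (S T : finType) (F F' : oedges S T) (h : F -> F') :
  bijective h -> (forall e e', ele (h e) (h e') = ele e e') ->
  forall b e, ext_edge b (h e) <-> ext_edge b e.
Proof.
move=> [k hk kh] hl b e.
have ohl c c' : ole b (h c) (h c') = ole b c c' by case: b => /=; rewrite hl.
split=> [xe e' ee'|xe e' ee'].
  by apply: (can_inj hk); apply: xe; rewrite ohl.
by rewrite -(kh e') (xe (k e')) // -ohl kh.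
Qed.

Lemma ole_ocomp (S T U : finType) (F : oedges S T) (G : oedges T U) b
    (p q : ocomp F G) :
  ole b p q = ((val p).2 != (val q).2) && ole b (val p).2 (val q).2
              || ((val p).2 == (val q).2) && ole b (val p).1 (val q).1.
Proof. by case: b => //=; rewrite /comp_le (eq_sym (val p).2). Qed.

(** An edge of a composite is extremal exactly when both its components are: the
    order is lexicographic, the second component being the dominant one. *)
Lemma ext_ocompP (S T U : finType) (F : oedges S T) (G : oedges T U) b
    (p : ocomp F G) :
  (forall t, exists e : F, rng e = t) ->
  ext_edge b p <-> ext_edge b (val p).1 /\ ext_edge b (val p).2.
Proof.
move=> Frng; split=> [xp|[x1 x2] q].
  split=> [e ee|g gg].
    have r : rng e == src (val p).2 by rewrite -(ole_rng ee); exact: (valP p).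
    by rewrite -(xp (Sub (e, (val p).2) r)) // ole_ocomp /= eqxx ee orbT.
  have [e /eqP r] := Frng (src g).
  apply/eqP; apply: contraT => ne; case/eqP: (ne).
  by rewrite -(xp (Sub (e, g) r)) // ole_ocomp /= gg andbT eq_sym ne.
rewrite ole_ocomp => /orP[/andP[/eqP ne /x2 E]|/andP[/eqP E /x1 E']].
  by rewrite E in ne.
by apply/val_inj/injective_projections.
Qed.

(** * Extremal threads and their invariance under isomorphism *)

(** The extremal edge with range [t] has source [s]; since this edge is unique,
    the relation is a partial function from ranges to sources, and a total one
    if every [t] is the range of some edge. *)
Definition elink b (S T : finType) (F : oedges S T) (s : S) (t : T) : Prop :=
  exists e : F, [/\ ext_edge b e, src e = s & rng e = t].

Section Elink.
Variables (b : bool).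

Lemma elink_uniq (S T : finType) (F : oedges S T) s s' t :
  elink b F s t -> elink b F s' t -> s = s'.
Proof.
move=> [e [xe <- et]] [e' [xe' <- e't]].
by rewrite (ext_edge_uniq xe xe') // et e't.
Qed.

Lemma elink_total (S T : finType) (F : oedges S T) t :
  (exists e : F, rng e = t) -> exists s, elink b F s t.
Proof. by case/(@ext_edge_exists _ _ F b) => e xe et; exists (src e), e. Qed.

Lemma elink_iso (S T : finType) (F F' : oedges S T) s t :
  oiso F F' -> elink b F s t -> elink b F' s t.
Proof.
move=> [h [bh hs hr hl]] [e [xe es et]].
by exists (h e); split; rewrite ?hs ?hr //; apply/(ole_iso bh hl).
Qed.

Lemma elink_comp (S T U : finType) (F : oedges S T) (G : oedges T U) s u :
  (forall t, exists e : F, rng e = t) ->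
  elink b (ocomp F G) s u <-> exists2 t, elink b F s t & elink b G t u.
Proof.
move=> Frng; split=> [[p [/(ext_ocompP _ _ Frng)[x1 x2] ps pu]]|].
  exists (rng (val p).1); first by exists (val p).1.
  by exists (val p).2; split=> //; exact/esym/eqP/(valP p).
case=> t [e [xe es et]] [g [xg gt gu]].
have eg : rng e == src g by rewrite et gt.
by exists (Sub (e, g) eg : ocomp F G); split=> //; apply/ext_ocompP.
Qed.

Lemma elink_diag (B : obd) k (v w : obd_V B k) :
  elink b (diag B k k) v w <-> v = w.
Proof.
split=> [[e [_ <- <-]]|<-]; first exact: diag_eq.
exists (diag_at v); split=> // e' /= h; apply/esym/eqP.
by case: b h => //; rewrite eq_sym.
Qed.

End Elink.
Arguments elink_comp {b S T U F G s u}.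

Lemma segment_rng (B : obd) k l : k <= l ->
  forall w, exists e : segment B k l, rng e = w.
Proof.
elim: l => [|l IH]; first by rewrite leqn0 => /eqP -> w; exact: id_rng.
rewrite leq_eqVlt => /orP[/eqP -> w|]; first exact: id_rng.
rewrite ltnS => kl w; rewrite segmentS //.
have [g gw] := obd_rng w; have [e /eqP eg] := IH kl (src g).
by exists (Sub (e, g) eg : ocomp _ _).
Qed.

Lemma dependent_choice (I : Type) (A : I -> Type) (P : forall i, A i -> Prop) :
  (forall i, exists x, P i x) -> exists f : forall i, A i, forall i, P i (f i).
Proof.
by move=> h; exists (fun i => sval (cid (h i))) => i; exact: svalP (cid (h i)).
Qed.

Section Threads.
Variable b : bool.

(** A sequence of vertices such that the extremal edge into each of them comes
    from the preceding one. *)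
Definition ethread (B : obd) (t : forall n, obd_V B n) : Prop :=
  forall n, elink b (obd_E B n) (t n) (t n.+1).

Definition uniq_ethread (B : obd) : Prop := exists! t, @ethread B t.

(** An infinite path of extremal edges amounts to a thread: its vertices
    determine its edges. *)
Lemma ext_path_threads (B : obd) :
  (exists! p : forall n, obd_E B n,
     infinite_path p /\ forall n, ext_edge b (p n)) <-> uniq_ethread B.
Proof.
have threadP (p : forall n, obd_E B n) :
    infinite_path p /\ (forall n, ext_edge b (p n)) ->
    ethread (fun n => src (p n)).
  by move=> [pp xp] n; exists (p n); split=> //; exact: pp.
have pathP (t : forall n, obd_V B n) : ethread t ->
    exists2 p : forall n, obd_E B n,
      infinite_path p /\ (forall n, ext_edge b (p n))
      & forall n, src (p n) = t n.
  move=> /dependent_choice[p pP]; exists p; last by move=> n; have [] := pP n.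
  split=> n; last by have [] := pP n.
  by have [_ _ ->] := pP n; have [_ ->] := pP n.+1.
split=> [[p [pP pu]]|[t [tP tu]]].
  exists (fun n => src (p n)); split; first exact: threadP.
  move=> t /pathP[q qP qt]; apply: functional_extensionality_dep => n.
  by rewrite (pu q qP) qt.
have [p pP pt] := pathP t tP; exists p; split=> // q qP.
apply: functional_extensionality_dep => n.
have [pp xp] := pP; have [qq xq] := qP.
apply: (@ext_edge_uniq _ _ _ b) => //; rewrite pp qq pt.
by rewrite (tu _ (threadP q qP)).
Qed.

Lemma ethread_segment (B : obd) (t : forall n, obd_V B n) k l :
  ethread t -> k <= l -> elink b (segment B k l) (t k) (t l).
Proof.
move=> tt; elim: l => [|l IH].
  by rewrite leqn0 => /eqP ->; rewrite segment_id; apply/elink_diag.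
rewrite leq_eqVlt => /orP[/eqP ->|].
  by rewrite segment_id; apply/elink_diag.
rewrite ltnS => kl; rewrite segmentS //.
by apply/(elink_comp (segment_rng kl)); exists (t l); [exact: IH|exact: tt].
Qed.

Section Pull.
Variables (B C : obd).

(** The extremal edges of the premorphism [f] send the thread [w] of [C] to the
    thread [t] of [B]. *)
Definition pull (f : premorphism B C) (w : forall n, obd_V C n)
    (t : forall n, obd_V B n) : Prop :=
  forall n, elink b (pm_edges f n) (t n) (w (pm_idx f n)).

Lemma pull_exists (f : premorphism B C) w : exists t, pull f w t.
Proof.
apply: (@dependent_choice _ _ (fun n v => elink b (pm_edges f n) v _)) => n.
by apply: elink_total; exact: pm_rng.
Qed.

Lemma pull_ethread (f : premorphism B C) w t :
  ethread w -> pull f w t -> ethread t.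
Proof.
move=> ww tP n.
have : elink b (ocomp (pm_edges f n) (segment C (pm_idx f n) (pm_idx f n.+1)))
    (t n) (w (pm_idx f n.+1)).
  apply/elink_comp; first exact: pm_rng.
  exists (w (pm_idx f n)) => //; apply: ethread_segment => //.
  exact: pm_idx_mono.
move/(elink_iso (oiso_sym (pm_comm f n)))/(elink_comp (@obd_rng B n)).
by case=> s ts /(elink_uniq (tP n.+1)) ->.
Qed.

(** Equivalent premorphisms send a thread to the same thread: the intertwining
    isomorphisms give equality at infinitely many levels, and the value of a
    thread at a level determines its values at all lower levels. *)
Lemma pull_equiv (f g : premorphism B C) w t t' : premorphism_equiv f g ->
  ethread w -> pull f w t -> pull g w t' -> t = t'.
Proof.
move=> [p [q [_ pq]]] ww tP tP'.
have tt' := pull_ethread ww tP'; have tt := pull_ethread ww tP.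
have p_ge k : k <= p k.
  elim: k => // k IH; have [/andP[lt1 lt2] _ _ _] := pq k.
  exact: leq_ltn_trans IH (ltn_trans lt1 lt2).
have eq_at k : t (p k) = t' (p k).
  have [/andP[lt1 _] /andP[lt2 _] i _] := pq k.
  have : elink b (ocomp (pm_edges f (p k))
      (segment C (pm_idx f (p k)) (pm_idx g (q k)))) (t (p k)) (w (pm_idx g (q k))).
    apply/elink_comp; first exact: pm_rng.
    exists (w (pm_idx f (p k))) => //; apply: ethread_segment => //.
    exact: ltnW.
  move/(elink_iso (oiso_sym i))/(elink_comp (segment_rng (ltnW lt1))).
  case=> s ts /(elink_uniq (tP' (q k))) E; rewrite -E in ts.
  exact: elink_uniq ts (ethread_segment tt' (ltnW lt1)).
apply: functional_extensionality_dep => n.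
have := ethread_segment tt' (p_ge n); rewrite -eq_at.
exact: elink_uniq (ethread_segment tt (p_ge n)).
Qed.

End Pull.

Lemma pull_id (B : obd) (t : forall n, obd_V B n) : pull (id_premorphism B) t t.
Proof. by move=> n; rewrite /= segment_id; apply/elink_diag. Qed.

Lemma pull_comp (B C D : obd) (f : premorphism B C) (g : premorphism C D) w t s :
  pull g w t -> pull f t s -> pull (comp_premorphism f g) w s.
Proof.
move=> wt ts n; apply/elink_comp; first exact: pm_rng.
by exists (t (pm_idx f n)); [exact: ts|exact: wt].
Qed.

(** Composition with an inverse recovers each thread of [B] from its image in
    [C], so a unique thread of [C] leaves no choice for the threads of [B]. *)
Lemma uniq_ethread_iso (B C : obd) :
  obd_isomorphic B C -> uniq_ethread C -> uniq_ethread B.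
Proof.
case=> f [g [/premorphism_classP fg _]] [w [ww wu]].
have [s sP] := pull_exists f w; exists s; split; first exact: pull_ethread sP.
move=> t tt; have [w' w'P] := pull_exists g t.
move: (wu _ (pull_ethread tt w'P)) => E; rewrite -{}E in w'P.
exact: pull_equiv fg tt (pull_comp w'P sP) (pull_id t).
Qed.

End Threads.

Lemma properly_orderedP (B : obd) :
  properly_ordered B <-> forall b, uniq_ethread b B.
Proof.
split=> [[hmax hmin] []|h]; [exact/ext_path_threads|exact/ext_path_threads|].
by split; [exact/(ext_path_threads true)|exact/(ext_path_threads false)].
Qed.

(** * Diagrams of systems are properly ordered *)

Lemma compact_decreasing (X : topologicalType) (D : nat -> set X) :
  compact [set: X] -> (forall n, closed (D n)) ->
  (forall n, D n.+1 `<=` D n) -> (forall n, D n !=set0) ->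
  \bigcap_n D n !=set0.
Proof.
move=> cX clD decr ne.
have mono m n : m <= n -> D n `<=` D m.
  elim: n => [|n IH]; first by rewrite leqn0 => /eqP ->.
  rewrite leq_eqVlt => /orP[/eqP -> //|]; rewrite ltnS => /IH h.
  by move=> x /decr /h.
pose F := filter_from [set: nat] D.
have FF : ProperFilter F.
  apply: filter_from_proper => //; apply: filter_fromT_filter; first by exists 0.
  move=> i j; exists (maxn i j) => x Dx.
  by split; apply: mono Dx; rewrite ?leq_maxl ?leq_maxr.
have [p [_ Fp]] := cX F FF (@filterT _ _ FF).
exists p => n _; apply: clD => U Up; apply: Fp => //; by exists n.
Qed.

Section KREdges.
Variables (X : topologicalType) (phi : X -> X) (x0 : X).
Notation krp := (kr_partition phi x0).

(** The top level of a tower if [b] is true and its bottom level otherwise. *)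
Definition kr_end b (P : krp) (k : 'I_(kr_num P)) : set X :=
  kr_level k (if b then (kr_height k).-1 else 0).

Lemma kr_end_lt b (P : krp) (k : 'I_(kr_num P)) :
  (if b then (kr_height k).-1 else 0) < kr_height k.
Proof. by case: b; rewrite ?prednK ?kr_height_gt0. Qed.

Lemma kr_end_inj b (P : krp) (k k' : 'I_(kr_num P)) x :
  kr_end b k x -> kr_end b k' x -> k = k'.
Proof.
move=> kx k'x.
by have [] := kr_level_inj (kr_end_lt b k) (kr_end_lt b k') kx k'x.
Qed.

Lemma kr_topE (P : krp) : kr_top P = \bigcup_k @kr_end true P k.
Proof. by apply: eq_bigcupr => k _; rewrite kr_last. Qed.

Lemma kr_bottomE (P : krp) : phi @` kr_top P = \bigcup_k @kr_end false P k.
Proof. by rewrite [LHS]kr_top_map; apply: eq_bigcupr => k _; rewrite kr_head. Qed.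

Variables P Q : krp.
Hypotheses (PQ : kr_refines P Q) (topPQ : kr_top Q `<=` kr_top P).

Lemma kr_level_sub (S : 'I_(kr_num P)) (T : 'I_(kr_num Q)) i j x :
  i < kr_height S -> j < kr_height T -> kr_level S i x -> kr_level T j x ->
  kr_level T j `<=` kr_level S i.
Proof.
move=> iS jT Sx Tx.
have [|_ [S' [i' [iS' ->]]] sub] := PQ (A := kr_level T j); first by exists T, j.
by have [-> ->] := kr_level_inj iS iS' Sx (sub _ Tx).
Qed.

(** A tower of the finer partition that enters a tower at its bottom follows it
    up to its top, as it may only end at a top level of the coarser partition. *)
Lemma kr_edge_of_bottom (S : 'I_(kr_num P)) (T : 'I_(kr_num Q)) k :
  k < kr_height T -> kr_level T k `<=` kr_level S 0 -> kr_edge S T k.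
Proof.
move=> kT sub; elim=> [|j IH] jS; first by rewrite addn0.
have [kjT subj] := IH (ltnW jS).
suff kjT' : (k + j).+1 < kr_height T.
  by rewrite addnS; split=> //; rewrite /kr_level -!kr_step //; exact: image_subset.
rewrite ltn_neqAle kjT andbT; apply/eqP => ht.
have [x Tx] := kr_level_neq0 kjT.
have : kr_top Q x by rewrite kr_topE; exists T => //; rewrite /kr_end -ht.
move/topPQ; rewrite kr_topE => -[S' _ S'x].
have [E jE] := kr_level_inj (ltnW jS) (kr_end_lt true S') (subj _ Tx) S'x.
by move: jS; rewrite jE -E prednK ?kr_height_gt0 // ltnn.
Qed.

(** An edge [(S, T, k)] is a passage of the tower [T] through the tower [S].  A
    tower of [Q] starts a passage at each of its levels that meets the image of
    the top of [P]. *)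
Lemma kr_edge_at (T : 'I_(kr_num Q)) k x :
  k < kr_height T -> kr_level T k x -> (phi @` kr_top P) x ->
  exists e : kr_edges P Q, rng e = T /\ tagged (val e).2 = k :> nat.
Proof.
rewrite kr_bottomE => kT Tx [S _ Sx].
have sub := kr_level_sub (kr_height_gt0 S) kT Sx Tx.
have e : `[< kr_edge (S, Tagged (fun T => 'I_(kr_height T)) (Ordinal kT)).1 T
                (Ordinal kT) >] by apply/asboolP/kr_edge_of_bottom.
by exists (Sub (S, Tagged (fun T => 'I_(kr_height T)) (Ordinal kT)) e).
Qed.

(** The maximal passage of a tower ends at its top level and the minimal one
    starts at its bottom level. *)
Lemma kr_ext_edge b (e : kr_edges P Q) :
  ext_edge b e -> kr_end b (rng e) `<=` kr_end b (src e).
Proof.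
move: e => -[[S [T k]] /= ek] xe.
have ek' : kr_edge S T k by exact/asboolP.
case: b xe => xe.
  have [kS sub] := ek' _ (kr_end_lt true S).
  (* Otherwise the tower would start a later passage right after [e]. *)
  suff ht : (k + (kr_height S).-1).+1 = kr_height T.
    by rewrite /kr_end /= -ht.
  apply/eqP; rewrite eqn_leq kS leqNgt; apply/negP => lt.
  have [x Tx] := kr_level_neq0 kS.
  have Tx' : kr_level T (k + (kr_height S).-1).+1 (phi x).
    by rewrite /kr_level -kr_step //; exists x.
  have [|e' [Te' pe']] := kr_edge_at lt Tx'.
    by exists x => //; rewrite kr_topE; exists S => //; exact: sub.
  have /xe E : ole true (exist _ (S, existT _ T k) ek : kr_edges P Q) e'.
    apply/andP; split; first by apply/eqP; exact: esym Te'.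
    by rewrite pe' /= (leq_trans (leq_addr (kr_height S).-1 k)).
  move: pe'; rewrite E /= => /eqP; rewrite ltn_eqF // ltnS leq_addr //.
have T0 := kr_height_gt0 T; have [x Tx] := kr_level_neq0 T0.
have bx : (phi @` kr_top P) x.
  have : (phi @` kr_top Q) x by rewrite kr_bottomE; exists T.
  exact: image_subset.
have [e' [Te' pe']] := kr_edge_at T0 Tx bx.
have /xe E : ole false (exist _ (S, existT _ T k) ek : kr_edges P Q) e'.
  apply/andP; split; first by apply/eqP; exact: Te'.
  by rewrite pe'.
move: pe'; rewrite E /= => k0.
have [_] := ek' 0 (kr_height_gt0 S).
by rewrite addn0 k0.
Qed.

End KREdges.

Section POrdered.
Variables (R : realType) (X : SDS R).
Notation phi := (@em_map R X).
Notation pt := (em_pt X).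

(** The end levels of a thread of towers decrease, so they have a common point,
    which can only be the distinguished point if they are top levels and its
    image if they are bottom levels. *)
Lemma P_obj_uniq_ethread b : uniq_ethread b (P_obj X).
Proof.
have [psi [phiK psiK phic psic]] := em_homeo X.
pose xb : X := if b then pt else phi pt.
have xbP n : (\bigcup_k @kr_end X phi pt b (sds_part X n) k) xb.
  rewrite /xb; case: (b); [rewrite -kr_topE|rewrite -kr_bottomE].
    exact: kr_top_pt.
  by exists pt => //; exact: kr_top_pt.
have /(@dependent_choice _ (fun n => 'I_(kr_num (sds_part X n)))
    (fun n k => kr_end b k xb))[t tP] :
  forall n, exists k : 'I_(kr_num (sds_part X n)), kr_end b k xb.
  by move=> n; have [k _ kx] := xbP n; exists k.
have linkP n S T : elink b (obd_E (P_obj X) n) S T -> kr_end b T `<=` kr_end b S.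
  move=> [e [xe <- <-]].
  exact: (kr_ext_edge (@sds_refine R X n) (@sds_top R X n)).
exists t; split.
  move=> n; have [S ST] := elink_total b (@obd_rng (P_obj X) n (t n.+1)).
  by have <- : S = t n := kr_end_inj (linkP _ _ _ ST _ (tP n.+1)) (tP n).
move=> s sP; apply: functional_extensionality_dep => n.
suff sx m : kr_end b (s m) xb by exact: kr_end_inj (tP n) (sx n).
have [||||y yP] := @compact_decreasing X (fun m => kr_end b (s m)).
- exact: em_compact.
- by move=> k; have [] := kr_clopen (kr_end_lt b (s k)).
- by move=> k; exact: linkP.
- by move=> k; exact: kr_level_neq0 (kr_end_lt b (s k)).
suff -> : xb = y by exact: yP.
have topP z : (forall k, kr_top (sds_part X k) z) -> z = pt.
  by move=> zP; have : [set pt] z by rewrite -sds_top_cap => k _; exact: zP.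
move: yP; rewrite /xb; case: (b) => yP.
  by apply/esym/topP => k; rewrite kr_topE; exists (s k) => //; exact: yP.
rewrite -(psiK y); congr (phi _); apply/esym/topP => k.
have [z kz <-] : (phi @` kr_top (sds_part X k)) y.
  by rewrite kr_bottomE; exists (s k) => //; exact: yP.
by rewrite phiK.
Qed.

End POrdered.

(** * Inverse limits of finite sets *)

(** The inverse limit of the finite sets [A n] along the maps [pi n]; [R] only
    serves as the field in which the distances take their values. *)
Definition ilim (R : realType) (A : nat -> finType)
    (pi : forall n, A n.+1 -> A n) : Type :=
  {x : forall n, A n | forall n, pi n (x n.+1) = x n}.

HB.instance Definition _ R A pi := gen_eqMixin (@ilim R A pi).
HB.instance Definition _ R A pi := gen_choiceMixin (@ilim R A pi).

Section InverseLimitMetric.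
Variables (R : realType) (A : nat -> finType) (pi : forall n, A n.+1 -> A n).
Notation X := (ilim R pi).
Implicit Types x y z : X.
Local Open Scope ring_scope.

Definition coord n x : A n := sval x n.

Lemma coord_pi n x : pi (coord n.+1 x) = coord n x.
Proof. exact: svalP x n. Qed.

Lemma coord_inj x y : (forall n, coord n x = coord n y) -> x = y.
Proof.
case: x y => [x xP] [y yP] h.
have E : x = y by apply: functional_extensionality_dep.
by move: yP {h}; rewrite -E => yP; congr exist; exact: Prop_irrelevance.
Qed.

Lemma coord_down x y m n :
  (m <= n)%N -> coord n x = coord n y -> coord m x = coord m y.
Proof.
elim: n => [|n IH]; first by rewrite leqn0 => /eqP ->.
rewrite leq_eqVlt => /orP[/eqP -> //|mn E].
by apply: IH => //; rewrite -coord_pi E coord_pi.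
Qed.

(** The distance of distinct threads is [1 / (m + 1)], where [m] is the first
    coordinate at which they differ. *)
Definition idist x y : R :=
  if pselect (exists n, coord n x != coord n y) is left h
  then (ex_minn h).+1%:R^-1 else 0.

(** Threads are closer than [1 / (n + 1)] exactly when they agree at level [n],
    hence also below. *)
Lemma idist_lt n x y : idist x y < n.+1%:R^-1 <-> coord n x = coord n y.
Proof.
rewrite /idist; case: pselect => [h|h].
  case: ex_minnP => m mne mmin.
  rewrite ltf_pV2 ?posrE // ltr_nat ltnS; split=> [nm|E].
    by apply/eqP; apply: contraT => /mmin; rewrite leqNgt nm.
  by rewrite ltnNge; apply/negP => /coord_down/(_ E)/eqP; rewrite (negPf mne).
split=> _; last by rewrite invr_gt0.
by apply/eqP; apply: contraT => ne; case: h; exists n.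
Qed.

Lemma idistP x y :
  (idist x y = 0 /\ x = y) \/
  exists2 n, idist x y = n.+1%:R^-1 & coord n x <> coord n y.
Proof.
rewrite /idist; case: pselect => [h|h].
  by right; case: ex_minnP => m mne _; exists m => //; exact/eqP.
left; split=> //; apply: coord_inj => n.
by apply/eqP; apply: contraT => ne; case: h; exists n.
Qed.

Lemma idist_ge n x y : coord n x <> coord n y -> n.+1%:R^-1 <= idist x y.
Proof. by move=> ne; rewrite leNgt; apply/negP => /idist_lt. Qed.

Lemma idist_ge0 x y : 0 <= idist x y.
Proof. by have [[-> _]//|[n -> _]] := idistP x y; rewrite invr_ge0. Qed.

Lemma idistxx x : idist x x = 0.
Proof. by have [[]//|[n _]] := idistP x x. Qed.

Lemma idist_positivity x y : idist x y = 0 -> x = y.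
Proof.
have [[]//|[n -> _] /eqP] := idistP x y.
by rewrite invr_eq0 pnatr_eq0.
Qed.

Lemma idist_sym x y : idist x y = idist y x.
Proof.
suff le u v : idist u v <= idist v u by apply/eqP; rewrite eq_le !le.
have [[-> _]|[n -> ne]] := idistP u v; first exact: idist_ge0.
by apply: idist_ge; exact: nesym.
Qed.

Lemma idist_triangle y x z : idist x z <= idist x y + idist y z.
Proof.
have [[-> _]|[n -> ne]] := idistP x z; first by rewrite addr_ge0 ?idist_ge0.
have [E|/eqP/idist_ge h] := eqVneq (coord n x) (coord n y).
  rewrite -[X in X <= _]add0r lerD ?idist_ge0 //; apply: idist_ge.
  by rewrite -E.
by rewrite -[X in X <= _]addr0 lerD ?idist_ge0.
Qed.

HB.instance Definition _ := @isMetric.Build R X idist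
  idistxx idist_positivity idist_sym idist_triangle.

End InverseLimitMetric.

Section InverseLimit.
Variables (R : realType) (A : nat -> finType) (pi : forall n, A n.+1 -> A n).
Notation X := (ilim R pi).
Implicit Types x y : X.

(** The cylinder of the threads through [a]. *)
Definition cyl n (a : A n) : set X := [set x | coord n x = a].

Lemma nbhs_cylP x (U : set X) : nbhs x U <-> exists n, cyl (coord n x) `<=` U.
Proof.
split=> [/nbhs_ballP[e /= e0 eU]|[n nU]].
  have [n _ /(_ n (leqnn n)) /= ne] := near_infty_natSinv_lt (PosNum e0).
  exists n => y /esym xy; apply: eU; rewrite ballEmdist /=.
  by apply: lt_trans ne; apply/idist_lt.
apply/nbhs_ballP; exists (n.+1%:R^-1)%R => /=.
  by rewrite invr_gt0 ltr0Sn.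
by move=> y; rewrite ballEmdist /= => /idist_lt xy; apply: nU; exact: esym.
Qed.

Lemma open_coord n (P : A n -> Prop) : open [set x : X | P (coord n x)].
Proof.
rewrite openE => x Px; apply/nbhs_cylP; exists n => y /= E.
by rewrite /cyl /= E.
Qed.

Lemma clopen_coord n (P : A n -> Prop) : clopen [set x : X | P (coord n x)].
Proof.
split; first exact: open_coord.
rewrite -[X in closed X]setCK; apply: open_closedC.
exact: (@open_coord n (fun a => ~ P a)).
Qed.

Lemma ilim_zero_dimensional : zero_dimensional X.
Proof.
move=> x y /eqP xy.
have [n ne] : exists n, coord n x <> coord n y.
  apply: contrapT => h; apply/xy/coord_inj => n.
  by apply: contrapT => ne; apply: h; exists n.
exists (cyl (coord n x)); split=> //; last exact: nesym.
exact: (@clopen_coord n (fun a => a = coord n x)).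
Qed.

(** An ultrafilter selects a value at every coordinate, because it contains one
    of the finitely many cylinders of each level. *)
Lemma ilim_compact : compact [set: X].
Proof.
rewrite compact_ultra => F FU _.
have FF := ultra_proper.
have /(@dependent_choice _ A)[l lP] n : exists a : A n, F (cyl a).
  apply: contrapT => h.
  have /filter_ex[x] : F [set x | forall a : A n, (~` cyl a) x].
    apply: filter_forall => a; have [Fa|//] := in_ultra_setVsetC (cyl a) FU.
    by case: h; exists a.
  by move=> /(_ (coord n x)); apply.
have lpi n : pi (l n.+1) = l n.
  have [x [x1 x2]] := filter_ex (filterI (lP n) (lP n.+1)).
  by rewrite -x1 -x2 coord_pi.
exists (exist _ l lpi); split=> // U /nbhs_cylP[n nU].
by apply: filterS nU _; exact: lP.
Qed.

Lemma ilim_basis : basis [set U | exists n (a : A n), U = cyl a].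
Proof.
split=> [U [n [a ->]]|x U /nbhs_cylP[n nU]].
  exact: (@open_coord n (fun c => c = a)).
by exists (cyl (coord n x)) => //; split=> //; exists n, (coord n x).
Qed.

(** A compatible family of relations with unique solutions at the level of
    threads is the graph of a continuous map. *)
Lemma ilim_graph (r : forall n, A n -> A n -> Prop) :
  (forall n (a : A n), exists x : X, coord n x = a) ->
  (forall n a, exists b, r n a b) ->
  (forall n a b, r n.+1 a b -> r n (pi a) (pi b)) ->
  (forall x y z, (forall n, r n (coord n x) (coord n y)) ->
     (forall n, r n (coord n x) (coord n z)) -> y = z) ->
  exists2 f : X -> X, continuous f & forall n x, r n (coord n x) (coord n (f x)).
Proof.
move=> surj tot comp uniq.
have decr x n y : r n.+1 (coord n.+1 x) (coord n.+1 y) -> r n (coord n x) (coord n y).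
  by rewrite -(coord_pi n x) -(coord_pi n y); exact: comp.
have /choice[f fP] x : exists y, forall n, r n (coord n x) (coord n y).
  have [||||y yP] := @compact_decreasing X
    (fun n => [set y | r n (coord n x) (coord n y)]).
  - exact: ilim_compact.
  - by move=> n; have [] := @clopen_coord n (r n (coord n x)).
  - by move=> n y; exact: decr.
  - move=> n; have [b rb] := tot n (coord n x); have [y yb] := surj n b.
    by exists y; rewrite /= yb.
  by exists y => n; exact: yP.
exists f => // x U /nbhs_cylP[n nU].
(* If every level m admitted a solution that differs from [f x] at level n, then
   so would the whole thread [x], by compactness. *)
have [m mP] : exists m, forall y, r m (coord m x) (coord m y) ->
    coord n y = coord n (f x).
  apply: contrapT => h.
  have [||||y yP] := @compact_decreasing X
    (fun m => [set y | r m (coord m x) (coord m y)] `&`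
              [set y | coord n y <> coord n (f x)]).
  - exact: ilim_compact.
  - move=> m; apply: closedI; first by have [] := @clopen_coord m (r m (coord m x)).
    by have [] := @clopen_coord n (fun a => a <> coord n (f x)).
  - by move=> m y [y1 y2]; split=> //; exact: decr.
  - move=> m; apply: contrapT => h'; apply: h; exists m => y ry.
    by apply: contrapT => ne; apply: h'; exists y.
  have [_] := yP 0 I; apply; congr (coord n _).
  by apply: (uniq x) => // k; have [] := yP k I.
apply/nbhs_cylP; exists m => y /= E; apply: nU; apply: mP.
by rewrite -E; exact: fP.
Qed.

End InverseLimit.

(** A thread through [a] is found by choosing preimages above the level of [a]
    and by projecting below it. *)
Lemma ilim_coord_surj (R : realType) n (A : nat -> finType)
    (pi : forall n, A n.+1 -> A n) (a : A n) :
  (forall n b, exists a, pi n a = b) -> exists x : ilim R pi, coord n x = a.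
Proof.
elim: n A pi a => [|n IH] A pi a surj.
  have /(@dependent_choice _ (fun n => A n -> A n.+1)
      (fun n g => forall b, pi n (g b) = b))
    [g gP] n : exists g : A n -> A n.+1, forall b, pi n (g b) = b.
    by have [g gP] := choice (surj n); exists g.
  pose x := fix x m : A m := if m is m'.+1 then g m' (x m') else a.
  have xP m : pi m (x m.+1) = x m by exact: gP.
  by exists (exist _ x xP).
have [x xa] := IH (fun m => A m.+1) (fun m => pi m.+1) a (fun m => surj m.+1).
pose y m : A m := if m is m'.+1 then coord m' x else pi 0 (coord 0 x).
have yP m : pi m (y m.+1) = y m by case: m => // m; exact: coord_pi.
by exists (exist _ y yP).
Qed.

(** * The Vershik map *)

Section PathSpace.
Variable B : obd.

(* Paths of length n from the root, with their lexicographic order. *)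
Notation fpath := (fun n => edge (segment B 0 n)).

(** The path without its last edge. *)
Definition trunc n (a : fpath n.+1) : fpath n :=
  (val (a : ocomp (segment B 0 n) (obd_E B n))).1.

Definition last_edge n (a : fpath n.+1) : obd_E B n :=
  (val (a : ocomp (segment B 0 n) (obd_E B n))).2.

Lemma trunc_last n (a : fpath n.+1) : rng (trunc a) = src (last_edge a).
Proof. exact/eqP/(valP (a : ocomp (segment B 0 n) (obd_E B n))). Qed.

Lemma fpath_extend n (a : fpath n) (e : obd_E B n) : rng a = src e ->
  exists a' : fpath n.+1, trunc a' = a /\ last_edge a' = e.
Proof.
by move=> /eqP ae; exists (Sub (a, e) ae : ocomp (segment B 0 n) (obd_E B n)).
Qed.

Lemma fpath_inj n (a a' : fpath n.+1) :
  trunc a = trunc a' -> last_edge a = last_edge a' -> a = a'.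
Proof. by move=> h1 h2; apply/val_inj/injective_projections. Qed.

Lemma ole_fpath b n (a a' : fpath n.+1) : ole b a a' =
  (last_edge a != last_edge a') && ole b (last_edge a) (last_edge a')
  || (last_edge a == last_edge a') && ole b (trunc a) (trunc a').
Proof. exact: (@ole_ocomp _ _ _ (segment B 0 n) (obd_E B n)). Qed.

Lemma ext_fpath b n (a : fpath n.+1) :
  ext_edge b a <-> ext_edge b (trunc a) /\ ext_edge b (last_edge a).
Proof. by apply: ext_ocompP; exact: segment_rng. Qed.

Lemma trunc_surj n (a : fpath n) : exists a' : fpath n.+1, trunc a' = a.
Proof.
have [e /esym ae] := obd_src (rng a).
by have [a' [a'a _]] := fpath_extend ae; exists a'.
Qed.

(** A path moves to the next path with the same range, in the direction given by
    [b]; an extremal path moves to any path that is extremal in the opposite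
    direction, the right one being decided by longer paths. *)
Definition step b n (a a' : fpath n) : Prop :=
  next_edge b a a' \/ ext_edge b a /\ ext_edge (~~ b) a'.

Lemma step_sym b n (a a' : fpath n) : step b a a' -> step (~~ b) a' a.
Proof.
case=> [[r p]|[xa xa']]; last by right; rewrite negbK.
by left; split=> //; case: (b) p.
Qed.

Lemma step_total b n (a : fpath n) : exists a', step b a a'.
Proof.
case: (pselect (ext_edge b a)) => [xa|/next_edge_exists[a' aa']].
  have [|a' xa' _] := @ext_edge_exists _ _ (segment B 0 n) (~~ b) (rng a).
    by exists a.
  by exists a'; right.
by exists a'; left.
Qed.

(** In the lexicographic order, consecutive paths either have the same last edge
    and consecutive truncations, or different last edges, a maximal truncation
    on one side and a minimal one on the other. *)
Lemma step_trunc b n (a a' : fpath n.+1) :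
  step b a a' -> step b (trunc a) (trunc a').
Proof.
case=> [/next_edgeP[]|[/ext_fpath[xa _] /ext_fpath[xa' _]]]; last by right.
have rE c c' : ole b (trunc c) c' -> rng c' = src (last_edge c).
  by move=> /ole_rng <-; exact: trunc_last.
have rE' c c' : ole b c' (trunc c) -> rng c' = src (last_edge c).
  by move=> /ole_rng ->; exact: trunc_last.
rewrite ole_fpath; have [E /=|ne /=] := eqVneq (last_edge a) (last_edge a').
  move=> le ne mid; left; apply/next_edgeP; split=> //.
    by apply: contra ne => /eqP E'; apply/eqP/fpath_inj.
  move=> c ac ca'; have [d [dc de]] := fpath_extend (rE _ _ _ ac).
  have [||<-|<-] := mid d; rewrite ?dc; [| |by left|by right].
    by rewrite ole_fpath de eqxx dc ac orbT.
  by rewrite ole_fpath de E eqxx dc ca' orbT.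
rewrite orbF => le _ mid; right; split=> c; last first.
  move=> a'c; have ca' : ole b c (trunc a') by case: (b) a'c.
  have [d [dc de]] := fpath_extend (rE' _ _ _ ca').
  have [||E|<- //] := mid d.
  - by rewrite ole_fpath de ne le.
  - by rewrite ole_fpath de eqxx dc ca' orbT.
  - by rewrite -de E eqxx in ne.
move=> ac; have [d [dc de]] := fpath_extend (rE _ _ _ ac).
have [||<- //|E] := mid d.
- by rewrite ole_fpath de eqxx dc ac orbT.
- by rewrite ole_fpath de ne le.
- by rewrite -de E eqxx in ne.
Qed.

Variable R : realType.
Notation X := (ilim R trunc).
Implicit Types x y : X.

(** The initial segment of length [n] of an infinite path. *)
Definition path_at n x : fpath n := coord n x.

Lemma trunc_path n x : trunc (path_at n.+1 x) = path_at n x.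
Proof. exact: (@coord_pi R _ trunc n x). Qed.

Lemma path_at_surj n (a : fpath n) : exists x, path_at n x = a.
Proof. exact: (@ilim_coord_surj R n _ trunc a trunc_surj). Qed.

Lemma ext_path_at b m n x :
  m <= n -> ext_edge b (path_at n x) -> ext_edge b (path_at m x).
Proof.
elim: n => [|n IH]; first by rewrite leqn0 => /eqP ->.
rewrite leq_eqVlt => /orP[/eqP -> //|mn /ext_fpath[h _]].
by apply: IH => //; rewrite -trunc_path.
Qed.

Lemma ext_path_ethread b x :
  (forall n, ext_edge b (path_at n x)) -> ethread b (fun n => rng (path_at n x)).
Proof.
move=> xx n; have /ext_fpath[_ xl] := xx n.+1.
by exists (last_edge (path_at n.+1 x)); split=> //; rewrite -trunc_last trunc_path.
Qed.

Hypothesis po : forall b, uniq_ethread b B.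

Lemma ext_path_uniq b x y : (forall n, ext_edge b (path_at n x)) ->
  (forall n, ext_edge b (path_at n y)) -> x = y.
Proof.
move=> xx yy; apply: coord_inj => n.
apply: (ext_edge_uniq (xx n) (yy n)).
have [t [_ tu]] := po b.
have := etrans (esym (tu _ (ext_path_ethread xx))) (tu _ (ext_path_ethread yy)).
by move=> /(congr1 (fun t => t n)).
Qed.

Lemma ext_path_exists b : exists x, forall n, ext_edge b (path_at n x).
Proof.
have [t [tt _]] := po b.
have /dependent_choice[a aP] n : exists a : fpath n, ext_edge b a /\ rng a = t n.
  have [a xa ar] := @ext_edge_exists _ _ (segment B 0 n) b _
    (segment_rng (leq0n n) (t n)).
  by exists a.
have api n : trunc (a n.+1) = a n.
  have [/ext_fpath[xa xl] ra] := aP n.+1; have [xa' ra'] := aP n.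
  apply: ext_edge_uniq xa xa' _; rewrite ra' trunc_last.
  have [e [xe <- er]] := tt n; congr src; apply: ext_edge_uniq xl xe _.
  by rewrite er -ra.
by exists (exist _ a api) => n; have [] := aP n.
Qed.

(** If the initial segments of [x] are all extremal then [y] is the unique thread
    that is extremal in the opposite direction; otherwise its long initial
    segments are the neighbours of those of [x]. *)
Lemma step_uniq b x y z :
  (forall n, step b (path_at n x) (path_at n y)) ->
  (forall n, step b (path_at n x) (path_at n z)) -> y = z.
Proof.
move=> xy xz; case: (pselect (forall n, ext_edge b (path_at n x))) => [xx|].
  have nx n c : ~ next_edge b (path_at n x) c.
    by move=> h; exact: next_edge_ext h (xx n).
  apply: (@ext_path_uniq (~~ b)) => n; first by case: (xy n) => [/nx|[]].
  by case: (xz n) => [/nx|[]].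
move=> /existsNP[m xm]; apply: coord_inj => n.
apply: (@coord_down _ _ _ _ _ _ (maxn m n)); first exact: leq_maxr.
have xmn : ~ ext_edge b (path_at (maxn m n) x).
  by apply: contra_not xm; exact: ext_path_at (leq_maxl m n).
case: (xy (maxn m n)) => [h1|[]//]; case: (xz (maxn m n)) => [h2|[]//].
exact: next_edge_uniq h1 h2.
Qed.

(** The Vershik map: the successor map on infinite paths, sending the maximal
    path to the minimal one. *)
Lemma vershik : exists phi psi : X -> X,
  [/\ cancel phi psi, cancel psi phi, continuous phi, continuous psi
    & forall n x, step true (path_at n x) (path_at n (phi x))].
Proof.
have graph b : exists2 f : X -> X, continuous f &
    forall n x, step b (path_at n x) (path_at n (f x)).
  apply: (@ilim_graph R _ trunc (step b)).
  - exact: path_at_surj.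
  - exact: step_total.
  - exact: step_trunc.
  - exact: step_uniq.
have [phi phic phiP] := graph true; have [psi psic psiP] := graph false.
exists phi, psi; split=> // x.
  apply: (@step_uniq false (phi x)) => n; first exact: psiP.
  exact: (step_sym (phiP n x)).
apply: (@step_uniq true (psi x)) => n; first exact: phiP.
exact: (step_sym (psiP n x)).
Qed.

End PathSpace.

(** * The path space as an essentially minimal system *)

Section PathSystem.
Variables (R : realType) (B : obd).
Notation X := (ilim R (@trunc B)).
Notation fpath := (fun n => edge (segment B 0 n)).
Implicit Types x y : X.

Hypothesis po : forall b, uniq_ethread b B.
(* The Vershik map, its inverse, and the maximal path. *)
Variables (phi psi : X -> X) (xmax : X).
Hypotheses (phiK : cancel phi psi) (psiK : cancel psi phi).
Hypotheses (phic : continuous phi) (psic : continuous psi).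
Hypothesis phiP : forall n x, step true (path_at n x) (path_at n (phi x)).
Hypothesis xmaxP : forall n, ext_edge true (path_at n xmax).

(** The infinite paths that pass through the vertex [v] of level [n] and whose
    initial segment of length [n] is the [j]-th path to [v], counted from 0. *)
Definition path_level n (v : obd_V B n) j : set X :=
  [set x | rng (path_at n x) = v /\ pos (path_at n x) = j].

Lemma path_level_neq0 n (v : obd_V B n) j :
  j < fib_size (segment B 0 n) v -> path_level v j !=set0.
Proof.
case/pos_surj => a av aj; have [x xa] := path_at_surj R a.
by exists x; rewrite /path_level /= xa.
Qed.

Lemma fib_size_gt0 n (v : obd_V B n) : 0 < fib_size (segment B 0 n) v.
Proof.
have [a <-] := segment_rng (leq0n n) v.
exact: leq_ltn_trans (leq0n _) (pos_bound a).
Qed.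

Lemma phi_next n x : ~ ext_edge true (path_at n x) ->
  next_edge true (path_at n x) (path_at n (phi x)).
Proof. by move=> nx; case: (phiP n x) => // -[]. Qed.

Lemma phi_ext n x :
  ext_edge true (path_at n x) <-> ext_edge false (path_at n (phi x)).
Proof.
case: (phiP n x) => [h|[h1 h2]] //; split=> [/(next_edge_ext h)//|].
have h' : next_edge false (path_at n (phi x)) (path_at n x) by case: h.
by move/(next_edge_ext h').
Qed.

Lemma phi_path_level n (v : obd_V B n) j : j.+1 < fib_size (segment B 0 n) v ->
  phi @` path_level v j = path_level v j.+1.
Proof.
move=> jv; apply/seteqP; split=> [_ [x [xv xj] <-]|y [yv yj]].
  have nx : ~ ext_edge true (path_at n x).
    by move/max_edge_pos; rewrite xv xj => E; rewrite E ltnn in jv.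
  by have [r p] := phi_next nx; split; rewrite -?r // p xj.
exists (psi y); last exact: psiK.
have ny : ~ ext_edge true (path_at n (psi y)).
  by move/phi_ext; rewrite psiK => /min_edge_pos; rewrite yj.
have [] := phi_next ny; rewrite psiK yv yj => r [p].
by split.
Qed.

(** The tower of the vertex with index [k]: the cylinders of the paths to this
    vertex, in increasing order. *)
Definition path_tower n (k : 'I_#|obd_V B n|) : seq (set X) :=
  mkseq (path_level (enum_val k)) (fib_size (segment B 0 n) (enum_val k)).

Lemma size_path_tower n (k : 'I_#|obd_V B n|) :
  size (path_tower k) = fib_size (segment B 0 n) (enum_val k).
Proof. exact: size_mkseq. Qed.

Lemma nth_path_tower n (k : 'I_#|obd_V B n|) j :
  j < size (path_tower k) ->
  nth set0 (path_tower k) j = path_level (enum_val k) j.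
Proof. by rewrite size_path_tower => jk; rewrite nth_mkseq. Qed.

Lemma path_tower_gt0 n (k : 'I_#|obd_V B n|) : 0 < size (path_tower k).
Proof. by rewrite size_path_tower fib_size_gt0. Qed.

Lemma path_tower_clopen n (k : 'I_#|obd_V B n|) j : j < size (path_tower k) ->
  clopen (nth set0 (path_tower k) j).
Proof.
move=> jk; rewrite nth_path_tower //.
exact: (@clopen_coord R _ (@trunc B) n (fun a => rng a = enum_val k /\ pos a = j)).
Qed.

Lemma path_tower_partition n :
  partition [set kj : 'I_#|obd_V B n| * nat | kj.2 < size (path_tower kj.1)]
    (fun kj => nth set0 (path_tower kj.1) kj.2) [set: X].
Proof.
split.
- apply/seteqP; split=> // x _.
  have lt : pos (path_at n x) < size (path_tower (enum_rank (rng (path_at n x)))).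
    by rewrite size_path_tower enum_rankK; exact: pos_bound.
  exists (enum_rank (rng (path_at n x)), pos (path_at n x)) => //=.
  by rewrite nth_path_tower //; split=> //; rewrite enum_rankK.
- move=> [k j] [k' j'] /= kj kj' [x []]; rewrite !nth_path_tower //.
  by move=> [r <-] [r' <-]; congr pair; apply: enum_val_inj; rewrite -r -r'.
- move=> [k j] /= kj; rewrite nth_path_tower //.
  by apply: path_level_neq0; rewrite -size_path_tower.
Qed.

Lemma path_tower_step n (k : 'I_#|obd_V B n|) j : j.+1 < size (path_tower k) ->
  phi @` nth set0 (path_tower k) j = nth set0 (path_tower k) j.+1.
Proof.
move=> jk; rewrite !nth_path_tower ?(ltnW jk) //; apply: phi_path_level.
by rewrite -size_path_tower.
Qed.

Lemma path_tower_top n :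
  \bigcup_k last set0 (@path_tower n k) = [set x | ext_edge true (path_at n x)].
Proof.
have E (k : 'I_#|obd_V B n|) : last set0 (path_tower k) =
    path_level (enum_val k) (fib_size (segment B 0 n) (enum_val k)).-1.
  rewrite -nth_last nth_path_tower ?size_path_tower //.
  by rewrite prednK // fib_size_gt0.
apply/seteqP; split=> [x [k _]|x /= /max_edge_pos xx].
  rewrite E => -[r p]; apply/max_edge_pos.
  by rewrite p r prednK // fib_size_gt0.
exists (enum_rank (rng (path_at n x))) => //; rewrite E enum_rankK.
by split=> //; rewrite -xx.
Qed.

Lemma path_tower_bottom n :
  \bigcup_k head set0 (@path_tower n k) = [set x | ext_edge false (path_at n x)].
Proof.
have E (k : 'I_#|obd_V B n|) : head set0 (path_tower k) = path_level (enum_val k) 0.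
  by rewrite -nth0 nth_path_tower // path_tower_gt0.
apply/seteqP; split=> [x [k _]|x /= /min_edge_pos xx].
  by rewrite E => -[r p]; apply/min_edge_pos.
by exists (enum_rank (rng (path_at n x))) => //; rewrite E enum_rankK.
Qed.

Lemma path_tower_top_pt n : (\bigcup_k last set0 (@path_tower n k)) xmax.
Proof. by rewrite path_tower_top; exact: xmaxP. Qed.

Lemma path_tower_top_map n : phi @` (\bigcup_k last set0 (@path_tower n k)) =
  \bigcup_k head set0 (@path_tower n k).
Proof.
rewrite path_tower_top path_tower_bottom; apply/seteqP; split.
  by move=> _ [x xx <-]; apply/phi_ext.
by move=> y yy; exists (psi y); rewrite ?psiK //; apply/phi_ext; rewrite psiK.
Qed.

Definition path_kr n : kr_partition phi xmax :=
  KRPartition (@path_tower_gt0 n) (@path_tower_clopen n)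
    (path_tower_partition n) (@path_tower_step n)
    (path_tower_top_pt n) (path_tower_top_map n).

Lemma path_kr_levelE n (k : 'I_(kr_num (path_kr n))) j :
  j < kr_height k -> kr_level k j = path_level (enum_val k) j.
Proof. exact: nth_path_tower. Qed.

Lemma path_kr_heightE n (k : 'I_(kr_num (path_kr n))) :
  kr_height k = fib_size (segment B 0 n) (enum_val k).
Proof. exact: size_path_tower. Qed.

Lemma path_kr_cells n : kr_cells (path_kr n) = [set U | exists a : fpath n, U = cyl a].
Proof.
apply/seteqP; split=> [U [k [j [jk ->]]]|U [a ->]].
  rewrite path_kr_levelE //; move: (jk); rewrite path_kr_heightE.
  case/pos_surj => a ak aj; exists a; apply/seteqP; split=> [x [xk xj]|x xa].
    by apply: pos_inj; [rewrite ak|rewrite aj].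
  by rewrite /path_level /= /path_at xa.
pose k : 'I_(kr_num (path_kr n)) := enum_rank (rng a).
have jk : pos a < kr_height k by rewrite path_kr_heightE enum_rankK; exact: pos_bound.
exists k, (pos a); split=> //; rewrite path_kr_levelE // enum_rankK.
apply/seteqP; split=> [x xa|x [xr xp]]; first by rewrite /path_level /= /path_at xa.
exact: pos_inj xr xp.
Qed.

Lemma path_kr_top n : kr_top (path_kr n) = [set x | ext_edge true (path_at n x)].
Proof. exact: path_tower_top. Qed.

(** A closed invariant set contains paths that are maximal up to any given
    length, because a path that is not is moved up by the map. *)
Lemma closed_invariant_xmax (N : set X) : closed_invariant phi N -> N xmax.
Proof.
move=> [[x0 Nx0] clN phiN].
have Nphi x : N x -> N (phi x) by move=> Nx; rewrite -phiN; exists x.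
have top n : exists2 x, N x & ext_edge true (path_at n x).
  have [m] := ubnP (fib_size (segment B 0 n) (rng (path_at n x0)) -
                    pos (path_at n x0)).
  elim: m x0 Nx0 => // m IH x Nx lt.
  case: (pselect (ext_edge true (path_at n x))) => [xx|/phi_next nx].
    by exists x.
  apply: (IH (phi x)); first exact: Nphi.
  have [r p] := nx; rewrite -r p subnS.
  move: lt; have := pos_bound (path_at n x); rewrite -subn_gt0.
  by case: (_ - _).
have [||||y yP] := @compact_decreasing X
    (fun n => N `&` [set x | ext_edge true (path_at n x)]).
- exact: ilim_compact.
- move=> n; apply: closedI => //.
  by have [] := @clopen_coord R _ (@trunc B) n (fun a => ext_edge true a).
- by move=> n y [Ny yy]; split=> //; exact: ext_path_at (leqnSn n) yy.
- by move=> n; have [x Nx xx] := top n; exists x.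
suff -> : xmax = y by have [] := yP 0 I.
by apply: (ext_path_uniq po xmaxP) => n; have [] := yP n I.
Qed.

(** The smallest non-empty closed invariant set. *)
Definition path_min : set X := \bigcap_(N in closed_invariant phi) N.

Lemma path_min_minimal : minimal_subset phi path_min.
Proof.
have min_xmax : path_min xmax by move=> N; exact: closed_invariant_xmax.
split; last first.
  move=> N NN NM; apply/seteqP; split=> // x; exact.
split; first by exists xmax.
  by apply: closed_bigI => N [].
apply/seteqP; split=> [_ [x xM <-] N NN|y yM].
  by have [_ _ <-] := NN; exists x => //; exact: xM.
exists (psi y); rewrite ?psiK // => N NN.
have : (phi @` N) y by have [_ _ ->] := NN; exact: yM.
by case=> x Nx <-; rewrite phiK.
Qed.

Fact path_metrizable : metrizable R X.
Proof. by exists X, id; exists id; split=> // x; exact: cvg_id. Qed.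

Fact path_disconnected : totally_disconnected [set: X].
Proof. exact/zero_dimension_totally_disconnected/ilim_zero_dimensional. Qed.

Fact path_homeo : homeomorphism phi.
Proof. by exists psi. Qed.

Fact path_minimal_uniq : exists! M, minimal_subset phi M.
Proof.
exists path_min; split; first exact: path_min_minimal.
move=> M [MM Mmin]; apply: Mmin; first by have [] := path_min_minimal.
by move=> x; exact.
Qed.

Fact path_pt_minimal : exists2 M, minimal_subset phi M & M xmax.
Proof.
exists path_min; first exact: path_min_minimal.
by move=> N; exact: closed_invariant_xmax.
Qed.

Definition path_system : em_system R :=
  @EMSystem R X path_metrizable (@ilim_compact R _ (@trunc B)) path_disconnected
    phi path_homeo path_minimal_uniq xmax path_pt_minimal.

Lemma path_kr0 : kr_cells (path_kr 0) = [set setT].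
Proof.
have /fintype_le1P A1 : #|segment B 0 0| <= 1 by rewrite id_edges0.
have cylT (a : fpath 0) : cyl a = [set: X].
  by apply/seteqP; split=> // x _; exact: A1.
rewrite path_kr_cells; apply/seteqP; split=> [U [a ->]|U ->].
  exact: cylT.
by exists (path_at 0 xmax); rewrite cylT.
Qed.

Lemma path_kr_refines n : kr_refines (path_kr n) (path_kr n.+1).
Proof.
move=> U; rewrite !path_kr_cells => -[a ->]; exists (cyl (trunc a)).
  by exists (trunc a).
by move=> x xa; rewrite /cyl /= -xa; exact/esym/trunc_path.
Qed.

Lemma path_kr_top_decr n : kr_top (path_kr n.+2) `<=` kr_top (path_kr n.+1).
Proof. by rewrite !path_kr_top => x; exact: ext_path_at. Qed.

Lemma path_kr_top_cap : \bigcap_n kr_top (path_kr n.+1) = [set xmax].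
Proof.
apply/seteqP; split=> [x xx|x ->]; last first.
  by move=> n _; rewrite path_kr_top; exact: xmaxP.
apply: (@ext_path_uniq B R po true) => // n.
apply: ext_path_at (leqnSn n) _.
by have := xx n I; rewrite path_kr_top.
Qed.

Lemma path_kr_basis : basis (\bigcup_n kr_cells (path_kr n)).
Proof.
have -> : \bigcup_n kr_cells (path_kr n) =
    [set U | exists n (a : fpath n), U = cyl a].
  apply/seteqP; split=> [U [n _]|U [n [a ->]]].
    by rewrite path_kr_cells => -[a ->]; exists n, a.
  by exists n => //; rewrite path_kr_cells; exists a.
exact: ilim_basis.
Qed.

Definition path_sds : SDS R :=
  @MkSDS R path_system path_kr path_kr0 path_kr_refines path_kr_top_decr
    path_kr_top_cap path_kr_basis.

End PathSystem.

(** * Levelwise isomorphic diagrams are isomorphic *)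

Section BijEdges.
Variables (S T : finType) (h : S -> T).
Hypothesis h_inj : injective h.

Fact bij_edges_comparable (s s' : S) : (s == s') || (s' == s) = (h s == h s').
Proof. by rewrite (eq_sym s') orbb inj_eq. Qed.

Fact bij_edges_anti : antisymmetric (@eq_op S).
Proof. by move=> s s' /andP[/eqP]. Qed.

Fact bij_edges_trans : transitive (@eq_op S).
Proof. by move=> s s' s'' /eqP ->. Qed.

(** The graph of an injective map [h], with one edge from [s] to [h s] for each
    [s]; no two edges have the same range. *)
Definition bij_edges : oedges S T :=
  @OEdges S T S id h eq_op (@eqxx S) bij_edges_anti bij_edges_trans
    bij_edges_comparable.

End BijEdges.

(** The maps [h n] between vertex sets extend to isomorphisms between the edge
    sets; this is a levelwise isomorphism of diagrams if they are bijective. *)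
Definition level_iso (B C : obd) (h : forall n, obd_V B n -> obd_V C n) : Prop :=
  forall n, exists k : obd_E B n -> obd_E C n,
    [/\ bijective k, forall e, src (k e) = h n (src e),
        forall e, rng (k e) = h n.+1 (rng e)
      & forall e e', ele (k e) (k e') = ele e e'].

Lemma level_iso_inv (B C : obd) (h : forall n, obd_V B n -> obd_V C n)
    (g : forall n, obd_V C n -> obd_V B n) :
  (forall n, cancel (h n) (g n)) -> level_iso h -> level_iso g.
Proof.
move=> hK iso n; have [k [[k' kK k'K] ks kr kl]] := iso n.
exists k'; split=> [|e|e|e e']; first by exists k.
- by rewrite -{2}(k'K e) ks hK.
- by rewrite -{2}(k'K e) kr hK.
- by rewrite -kl !k'K.
Qed.

Section LevelPremorphism.
Variables (B C : obd) (h : forall n, obd_V B n -> obd_V C n)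
  (g : forall n, obd_V C n -> obd_V B n).
Hypotheses (hK : forall n, cancel (@h n) (@g n)) (gK : forall n, cancel (@g n) (@h n)).
Hypothesis iso : level_iso h.

Let E n := bij_edges (can_inj (@hK n)).

Fact level_pm_gt0 n : 0 < #|E n|.
Proof. exact: obd_V_gt0. Qed.

Fact level_pm_src n v : exists e : E n, src e = v.
Proof. by exists v. Qed.

Fact level_pm_rng n w : exists e : E n, rng e = w.
Proof. by exists (g w); exact: gK. Qed.

Fact level_pm_edges0 : #|E 0| = 1.
Proof. exact: obd_V0. Qed.

Fact level_pm_comm n :
  oiso (ocomp (obd_E B n) (E n.+1)) (ocomp (E n) (segment C n n.+1)).
Proof.
have [k [[k' kK k'K] ks kr kl]] := iso n.
apply: oiso_trans (ocomp_congr (oiso_refl _) (oiso_sym (segment1 C n))).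
have P1 (p : ocomp (obd_E B n) (E n.+1)) :
    rng (src (val p).1 : E n) == src (k (val p).1) by rewrite ks.
have P2 (p : ocomp (E n) (obd_E C n)) :
    rng (k' (val p).2) == src (rng (k' (val p).2) : E n.+1) by [].
have srcE (p : ocomp (E n) (obd_E C n)) : src (k' (val p).2) = (val p).1.
  by apply: (can_inj (@hK n)); rewrite -ks k'K; exact/esym/eqP/(valP p).
have rngE (p : ocomp (obd_E B n) (E n.+1)) : (val p).2 = rng (val p).1.
  exact/esym/eqP/(valP p).
apply: (@oiso_of _ _ (ocomp (obd_E B n) (E n.+1)) (ocomp (E n) (obd_E C n))
  (fun p => Sub (src (val p).1 : E n, k (val p).1) (P1 p))
  (fun p => Sub (k' (val p).2, rng (k' (val p).2) : E n.+1) (P2 p))).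
- move=> p; apply: val_inj; rewrite /= kK.
  by apply: injective_projections => //=; rewrite rngE.
- by move=> p; apply: val_inj; rewrite /= k'K srcE -surjective_pairing.
- by [].
- by move=> p /=; rewrite kr rngE.
move=> p q; rewrite /= /comp_le /= !rngE kl (can_eq kK).
case: (eqVneq (val p).1 (val q).1) => [->|ne] /=; first by rewrite !eqxx /= ele_refl.
rewrite orbF; case: eqVneq => [//|ne'] /=; apply/negbTE/negP => le.
by move: ne'; rewrite -ele_comparable le.
Qed.

(** The premorphism made of the graphs of the vertex bijections. *)
Definition level_pm : premorphism B C :=
  @Premorphism B C id E erefl leqnSn (fun N => ex_intro _ N.+1 (ltnSn N))
    level_pm_gt0 level_pm_src level_pm_rng level_pm_edges0 level_pm_comm.

End LevelPremorphism.

(** The composite of the premorphisms of mutually inverse levelwise isomorphisms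
    consists of identity graphs. *)
Lemma level_pm_id (B C : obd) (h : forall n, obd_V B n -> obd_V C n)
    (g : forall n, obd_V C n -> obd_V B n)
    (hK : forall n, cancel (h n) (g n)) (gK : forall n, cancel (g n) (h n))
    (ih : level_iso h) (ig : level_iso g) :
  premorphism_equiv (comp_premorphism (level_pm hK gK ih) (level_pm gK hK ig))
    (id_premorphism B).
Proof.
have compE n : oiso (ocomp (bij_edges (can_inj (hK n))) (bij_edges (can_inj (gK n))))
    (segment B n n).
  rewrite segment_id.
  have P (e : diag B n n) : rng (src e : bij_edges (can_inj (hK n))) ==
    src (h n (src e) : bij_edges (can_inj (gK n))) by [].
  have pE (p : ocomp (bij_edges (can_inj (hK n))) (bij_edges (can_inj (gK n)))) :
    (val p).2 = h n (val p).1 by exact/esym/eqP/(valP p).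
  apply: (@oiso_of _ _
    (ocomp (bij_edges (can_inj (hK n))) (bij_edges (can_inj (gK n)))) (diag B n n)
    (fun p => diag_at (val p).1) (fun e => Sub (src e, h n (src e)) (P e))).
  - move=> p; apply: val_inj; apply: injective_projections => //=.
    exact/eqP/(valP p).
  - by move=> e; exact/esym/diag_atE.
  - by [].
  - by move=> p /=; rewrite pE hK.
  - move=> p q; rewrite /= /comp_le /= -val_eqE /= xpair_eqE andbb.
    by rewrite !pE (can_eq (hK n)); case: eqP.
have comm m n (F : oedges (obd_V B n) (obd_V B n)) (G : oedges (obd_V B m) (obd_V B m)) :
    oiso F (segment B n n) -> oiso G (segment B m m) ->
    oiso (ocomp (segment B m n) F) (ocomp G (segment B m n)).
  move=> iF iG; apply: oiso_trans (ocomp_congr (oiso_refl _) iF) _.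
  rewrite segment_id; apply: oiso_trans (ocomp_diagr _) _.
  apply: oiso_sym; apply: oiso_trans (ocomp_congr iG (oiso_refl _)) _.
  by rewrite segment_id; exact: ocomp_diagl.
exists (fun k => k.*2.+1), (fun k => k.*2.+2); split=> // k.
split.
- by rewrite doubleS !ltnS leqnn.
- by rewrite /= doubleS !ltnS leqnn.
- by apply: comm; [exact: oiso_refl|exact: compE].
- by apply: comm; [exact: compE|exact: oiso_refl].
Qed.

Lemma level_iso_isomorphic (B C : obd) (h : forall n, obd_V B n -> obd_V C n) :
  (forall n, bijective (h n)) -> level_iso h -> obd_isomorphic B C.
Proof.
move=> bh ih.
have /(@dependent_choice _ _ (fun n g => cancel (h n) g /\ cancel g (h n)))[g gP] n :
  exists g, cancel (h n) g /\ cancel g (h n) by have [g hg gh] := bh n; exists g.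
have hK n : cancel (h n) (g n) by have [] := gP n.
have gK n : cancel (g n) (h n) by have [] := gP n.
have ig := level_iso_inv hK ih.
exists (level_pm hK gK ih), (level_pm gK hK ig).
by split; apply/premorphism_classP; exact: level_pm_id.
Qed.

(** * The diagram of the path space *)

Section PathDiagram.
Variables (R : realType) (B : obd).
Notation X := (ilim R (@trunc B)).
Variables (po : forall b, uniq_ethread b B).
Variables (phi psi : X -> X) (xmax : X).
Hypotheses (phiK : cancel phi psi) (psiK : cancel psi phi).
Hypotheses (phic : continuous phi) (psic : continuous psi).
Hypothesis phiP : forall n x, step true (path_at n x) (path_at n (phi x)).
Hypothesis xmaxP : forall n, ext_edge true (path_at n xmax).

Let C : obd := P_obj (path_sds po phiK psiK phic psic phiP xmaxP).
Let P n := path_kr psiK phiP xmaxP n.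

(** The edge [e] corresponds to the passage that starts with the path made of
    the minimal path to the source of [e], followed by [e]. *)
Lemma path_level_iso : @level_iso B C (fun n => @enum_rank (obd_V B n)).
Proof.
move=> n.
have /choice[m mP] v : exists a : segment B 0 n, ext_edge false a /\ rng a = v.
  have [a xa av] := @ext_edge_exists _ _ (segment B 0 n) false _
    (segment_rng (leq0n n) v).
  by exists a.
have /choice[q qP] e : exists a : segment B 0 n.+1,
    trunc a = m (src e) /\ last_edge a = e.
  by apply: fpath_extend; have [] := mP (src e).
have rq e : rng (q e) = rng e.
  by have [_ {2}<-] := qP e.
have qlt e : pos (q e) < kr_height (enum_rank (rng e) : 'I_(kr_num (P n.+1))).
  by rewrite path_kr_heightE enum_rankK -rq; exact: pos_bound.
have k_edge e : kr_edge (enum_rank (src e) : 'I_(kr_num (P n)))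
    (enum_rank (rng e) : 'I_(kr_num (P n.+1))) (pos (q e)).
  apply: kr_edge_of_bottom => //.
    exact: (@sds_top R (path_sds po phiK psiK phic psic phiP xmaxP) n).
  rewrite !path_kr_levelE //; last exact: kr_height_gt0.
  rewrite !enum_rankK => x [xr xp].
  have xq : path_at n.+1 x = q e by apply: pos_inj; rewrite ?rq.
  rewrite /path_level /= -trunc_path xq; have [-> _] := qP e.
  by have [/min_edge_pos -> ->] := mP (src e).
pose k e : obd_E C n := exist _ (enum_rank (src e) : 'I_(kr_num (P n)),
  existT (fun T : 'I_(kr_num (P n.+1)) => 'I_(kr_height T)) (enum_rank (rng e))
   (Ordinal (qlt e))) (introT (asboolP _) (k_edge e)).
have kl e e' : ele (k e) (k e') = ele e e'.
  have -> : ele (k e) (k e') = (rng e == rng e') && (pos (q e) <= pos (q e')).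
    by rewrite /= /kr_edge_le /= (can_eq (@enum_rankK _)).
  have [qt ql] := qP e; have [qt' ql'] := qP e'.
  case: eqVneq => [r|ne] /=; last first.
    by apply/esym/negbTE/negP => le; move: ne; rewrite -ele_comparable le.
  rewrite -ele_pos ?rq // -[LHS]/(ole true (q e) (q e')) ole_fpath ql ql' qt qt'.
  by case: (eqVneq e e') => [->|_] /=; rewrite ?ele_refl ?orbF.
have ksurj (c : obd_E C n) : exists e, k e = c.
  pose S : 'I_(kr_num (P n)) := src c; pose T : 'I_(kr_num (P n.+1)) := rng c.
  pose i : 'I_(kr_height T) := tagged (val c).2.
  have ei : kr_edge S T i by exact/asboolP/(valP c).
  have [a aT ai] : exists2 a : segment B 0 n.+1, rng a = enum_val T & pos a = i.
    by apply: pos_surj; rewrite -path_kr_heightE.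
  have a0 : pos (trunc a) = 0.
    have [x xa] := path_at_surj R a.
    have [iT sub] := ei 0 (kr_height_gt0 S); rewrite addn0 in iT sub.
    have /sub : kr_level T i x by rewrite path_kr_levelE //; split; rewrite xa.
    by rewrite path_kr_levelE ?kr_height_gt0 // -xa trunc_path => -[].
  have qa : q (last_edge a) = a.
    have [qt ql] := qP (last_edge a); apply: fpath_inj => //; rewrite qt.
    have [xm rm] := mP (src (last_edge a)).
    by apply: ext_edge_uniq xm _ _; [exact/min_edge_pos|rewrite rm trunc_last].
  have rT : rng (k (last_edge a)) = T.
    by rewrite /= -rq qa aT enum_valK.
  have pi : tagged (val (k (last_edge a))).2 = i :> nat by rewrite /= qa.
  (* Edges of [C] with the same range and the same starting level are equal. *)
  exists (last_edge a); apply: (@ele_anti _ _ (obd_E C n)).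
  by apply/andP; split; apply/andP; split; rewrite ?pi //; apply/eqP.
exists k; split=> //.
have [k' k'P] := choice ksurj; exists k' => // e; apply: ele_anti.
by rewrite -!kl k'P ele_refl.
Qed.

Lemma path_diagram : obd_isomorphic B C.
Proof.
apply: level_iso_isomorphic path_level_iso => n.
by exists enum_val; [exact: enum_rankK|exact: enum_valK].
Qed.

End PathDiagram.

Theorem lemma3p9 (R : realType) (B : obd) :
  (exists X : SDS R, obd_isomorphic B (P_obj X)) <-> properly_ordered B.
Proof.
rewrite properly_orderedP; split=> [[X iso] b|po].
  exact: uniq_ethread_iso iso (P_obj_uniq_ethread X b).
have [phi [psi [phiK psiK phic psic phiP]]] := vershik R po.
have [xmax xmaxP] := ext_path_exists R po true.
exists (path_sds po phiK psiK phic psic phiP xmaxP); exact: path_diagram.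
Qed.
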